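(* Let $(M,j)$ be a complex manifold. (1) Let $\lambda=\pm1$ and $\ell=\pm1$. Integrable $(\lambda,\ell)$-structures on $(M,j)$ interpolate between integrable $(\lambda,0)$-structures and integrable $(0,\ell)$-structures on $(M,j)$, in the following sense: if sections of $\mathrm{End}(TM\oplus T^*M)$ of the block forms $$R=\begin{pmatrix} r & 0\\ 0 & t\end{pmatrix}\qquad\text{and}\qquad Q=\begin{pmatrix} 0 & p\\ \omega^\flat & 0\end{pmatrix}$$ (with respect to the splitting $TM\oplus T^*M$, where $\omega$ is a field of bilinear forms on $TM$) are integrable $(\lambda,\ell)$-structures on $(M,j)$, then $r$ is an integrable $(\lambda,0)$-structure on $(M,j)$ and $\omega$ is an integrable $(0,\ell)$-structure on $(M,j)$. (2) Let $\ell=\pm1$. If sections of $\mathrm{End}(TM\oplus T^*M)$ of the block forms $$R=\begin{pmatrix} r & 0\\ 0 & t\end{pmatrix}\qquad\text{and}\qquad Q=\begin{pmatrix} 0 & p\\ \omega^\flat & 0\end{pmatrix}$$ (with respect to the splitting $TM\oplus T^*M$, where $\omega$ is a field of bilinear forms on $TM$) are $(+)$-integrable $(1,\ell)$-structures on $(M,j)$, then $r$ is a $(+)$-integrable $(1,0)$-structure on $(M,j)$ and $\omega$ is an integrable $(0,\ell)$-structure on $(M,j)$.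
   Context: All objects are $C^\infty$. For a smooth manifold $M$ put $\mathbb{T}M=TM\oplus T^*M$, with the split pseudo-Riemannian structure $b(u+\sigma,v+\tau)=\tau(u)+\sigma(v)$ and the Courant bracket $[u+\sigma,v+\tau]=[u,v]+\mathcal L_u\tau-\mathcal L_v\sigma-\tfrac12 d(\tau(u)-\sigma(v))$. For a bilinear form $c$ on $V$, $c^\flat:V\to V^*$ is $c^\flat(u)(v)=c(u,v)$. A real linear isomorphism $S$ with $S^2=\lambda\,\mathrm{id}$, $\lambda=\pm1$, is called split if it has exactly two eigenspaces (in the complexification if $\lambda=-1$), of the same dimension (automatic if $\lambda=-1$). Let $S$ be a smooth section of $\mathrm{End}(\mathbb{T}M)$ with $S^2=\lambda\,\mathrm{id}$, $S$ split and skew-symmetric for $b$. $S$ is a generalized complex structure (if $\lambda=-1$), respectively a generalized paracomplex structure (if $\lambda=1$), if the smooth sections of the $\sqrt\lambda$-eigenbundle and those of the $-\sqrt\lambda$-eigenbundle of $S$ are each closed under the Courant bracket (extended $\mathbb C$-bilinearly to the complexification when $\lambda=-1$). A $(+)$-generalized paracomplex structure is defined like a generalized paracomplex structure, except that closedness is required only for sections of the $1$-eigenbundle. A paracomplex structure on $M$ is a tensor field $r$ of type $(1,1)$ with $r^2=\mathrm{id}$ whose $\pm1$-eigendistributions are integrable and of equal dimension. A complex structure is a tensor field $j$ of type $(1,1)$ with $j^2=-\mathrm{id}$ whose $\pm i$-eigendistributions in $TM\otimes\mathbb C$ are involutive. Let $(M,j)$ be a complex manifold. - An integrable $(1,0)$-structure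 on $(M,j)$ is a paracomplex structure $r$ on $M$ with $rj=-jr$. - An integrable $(-1,0)$-structure is a complex structure $r$ on $M$ with $rj=-jr$. - An integrable $(0,1)$-structure is a symplectic form $\omega$ on $M$ for which $j$ is skew-symmetric ($\omega(ju,v)=-\omega(u,jv)$). - An integrable $(0,-1)$-structure is a symplectic form $\omega$ on $M$ for which $j$ is symmetric ($\omega(ju,v)=\omega(u,jv)$). - A $(+)$-integrable $(1,0)$-structure is a tensor field $r$ of type $(1,1)$ with $r^2=\mathrm{id}$, $rj=-jr$, whose $1$-eigendistribution is integrable. For $\ell=\pm1$ let $J_\ell=\begin{pmatrix} j&0\\0&\ell j^*\end{pmatrix}$ on $\mathbb{T}M$. For $\lambda,\ell=\pm1$, an integrable $(\lambda,\ell)$-structure on $(M,j)$ is a generalized complex structure (if $\lambda=-1$), resp. generalized paracomplex structure (if $\lambda=1$), $S$ on $M$ with $SJ_\ell=-J_\ell S$. A $(+)$-integrable $(1,\ell)$-structure on $(M,j)$ is a $(+)$-generalized paracomplex structure $S$ on $M$ with $SJ_\ell=-J_\ell S$. *)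

(* Defs.v *)
(* A smooth manifold is a Hausdorff, second countable space with a smooth atlas
   (not assumed to be maximal); a tensor field is the family of its component
   functions in the charts of the atlas, subject to the usual transformation
   law, and brackets are given by their coordinate expressions. *)
From HB Require Import structures.
From mathcomp Require Import all_boot all_order all_algebra.
From mathcomp Require Import all_classical all_reals all_analysis.
From mathcomp Require Import complex.

Set Implicit Arguments.
Unset Strict Implicit.
Unset Printing Implicit Defensive.

Import Order.TTheory GRing.Theory Num.Theory numFieldNormedType.Exports.

Local Open Scope classical_set_scope.
Local Open Scope ring_scope.

Variant sign := Plus | Minus.

Definition sval_sign (R : realType) (s : sign) : R :=
  match s with Plus => 1 | Minus => -1 end.

Section Smoothness.
Context {R : realType}.

Definition pd n (i : 'I_n) (f : 'cV[R]_n -> R) (x : 'cV[R]_n) : R :=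
  'D_(delta_mx i 0) f x.

(* k-times Frechet differentiable at all points of U *)
Fixpoint diff_times n (k : nat) (U : set 'cV[R]_n) (f : 'cV[R]_n -> R) : Prop :=
  match k with
  | 0 => True
  | k'.+1 => (forall x, U x -> differentiable f x) /\
             (forall i, diff_times k' U (pd i f))
  end.

(* C^oo on U; only used for open U *)
Definition smooth_on n (U : set 'cV[R]_n) (f : 'cV[R]_n -> R) : Prop :=
  forall k, diff_times k U f.

Definition smooth_mx n p q (U : set 'cV[R]_n) (F : 'cV[R]_n -> 'M[R]_(p, q)) :
    Prop :=
  forall i j, smooth_on U (fun x => F x i j).

Definition jac n m (f : 'cV[R]_n -> 'cV[R]_m) (x : 'cV[R]_n) : 'M[R]_(m, n) :=
  \matrix_(i < m, k < n) pd k (fun y => f y i 0) x.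

End Smoothness.

Record manifold (R : realType) (n : nat) (M : topologicalType) := Manifold {
  hausdorffM : hausdorff_space M;
  second_countableM : @second_countable M;
  chart : Type;
  cdom : chart -> set M;
  cmap : chart -> M -> 'cV[R]_n;
  cinv : chart -> 'cV[R]_n -> M;
  cdom_cover : \bigcup_a cdom a = setT;
  cdom_open : forall a, open (cdom a);
  cimg_open : forall a, open (cmap a @` cdom a);
  cmapK : forall a p, cdom a p -> cinv a (cmap a p) = p;
  cmap_continuous : forall a p, cdom a p -> {for p, continuous (cmap a)};
  cinv_continuous : forall a x, (cmap a @` cdom a) x ->
    {for x, continuous (cinv a)};
  ctrans_smooth : forall a b,
    smooth_mx (cmap a @` (cdom a `&` cdom b)) (fun x => cmap b (cinv a x))
}.

Section Coordinates.
Context {R : realType} {n : nat}.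
Implicit Types u v s t : 'cV[R]_n -> 'cV[R]_n.

Definition grad (f : 'cV[R]_n -> R) (x : 'cV[R]_n) : 'cV[R]_n :=
  \col_k pd k f x.

(* [u, v]^k = \sum_i (u^i d_i v^k - v^i d_i u^k) *)
Definition lie_bracket u v (x : 'cV[R]_n) : 'cV[R]_n :=
  jac v x *m u x - jac u x *m v x.

(* (L_u t)_k = \sum_i (u^i d_i t_k + t_i d_k u^i) *)
Definition lie_deriv u t (x : 'cV[R]_n) : 'cV[R]_n :=
  jac t x *m u x + (jac u x)^T *m t x.

(* t(u), for the column t of components of a covector *)
Definition pairing (t u : 'cV[R]_n) : R := (t^T *m u) 0 0.

(* A vector u + s of TM (+) T^*M is the column col_mx u s. *)
Definition courant_bracket (X Y : 'cV[R]_n -> 'cV[R]_(n + n)) (x : 'cV[R]_n) :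
    'cV[R]_(n + n) :=
  let u y := usubmx (X y) in
  let s y := dsubmx (X y) in
  let v y := usubmx (Y y) in
  let t y := dsubmx (Y y) in
  col_mx (lie_bracket u v x)
         (lie_deriv u t x - lie_deriv v s x
          - 2^-1 *: grad (fun y => pairing (t y) (u y) - pairing (s y) (v y)) x).

Definition split_form (X Y : 'cV[R]_(n + n)) : R :=
  pairing (dsubmx Y) (usubmx X) + pairing (dsubmx X) (usubmx Y).

(* The matrix W of a bilinear form w: w(u, v) = u^T W v. *)
Definition bil (W : 'M[R]_n) (u v : 'cV[R]_n) : R := (u^T *m W *m v) 0 0.

(* The matrix of w^flat : u |-> w(u, _); indeed
   pairing (flat W *m u) v = bil W u v. *)
Definition flat (W : 'M[R]_n) : 'M[R]_n := W^T.

Definition re_field m (Z : 'cV[R]_n -> 'cV[R[i]]_m) (x : 'cV[R]_n) : 'cV[R]_m :=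
  map_mx (@complex.Re R) (Z x).

Definition im_field m (Z : 'cV[R]_n -> 'cV[R[i]]_m) (x : 'cV[R]_n) : 'cV[R]_m :=
  map_mx (@complex.Im R) (Z x).

Definition complexify p q (A : 'M[R]_(p, q)) : 'M[R[i]]_(p, q) :=
  map_mx (fun x => x%:C%C) A.

Definition C_bilinear_ext m
    (B : ('cV[R]_n -> 'cV[R]_m) -> ('cV[R]_n -> 'cV[R]_m) ->
         'cV[R]_n -> 'cV[R]_m)
    (Z W : 'cV[R]_n -> 'cV[R[i]]_m) (x : 'cV[R]_n) : 'cV[R[i]]_m :=
  complexify (B (re_field Z) (re_field W) x - B (im_field Z) (im_field W) x)
  + 'i%C *: complexify (B (re_field Z) (im_field W) x
                        + B (im_field Z) (re_field W) x).

End Coordinates.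

(* Eigenspaces for the action on columns, whence the transpose. *)
Definition col_eigenspace (F : fieldType) m (A : 'M[F]_m) (e : F) : 'M[F]_m :=
  eigenspace A^T e.

Definition two_equal_eigenspaces (F : fieldType) m (A : 'M[F]_m) : Prop :=
  exists e f : F, [/\ e != f,
    forall x, eigenvalue A^T x <-> x = e \/ x = f &
    \rank (col_eigenspace A e) = \rank (col_eigenspace A f)].

Section Geometry.
Context {R : realType} {n : nat} {M : topologicalType} (A : manifold R n M).

Definition cimg (a : chart A) : set 'cV[R]_n := cmap a @` cdom a.

Definition coverlap (a b : chart A) : set 'cV[R]_n :=
  cmap a @` (cdom a `&` cdom b).

Definition ctrans (a b : chart A) (x : 'cV[R]_n) : 'cV[R]_n :=
  cmap b (cinv a x).

(* Transition matrices of TM and of TM (+) T^*M from chart a to chart b, at the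
   point with coordinates x in the chart a *)
Definition transT (a b : chart A) (x : 'cV[R]_n) : 'M[R]_n := jac (ctrans a b) x.

Definition transTT (a b : chart A) (x : 'cV[R]_n) : 'M[R]_(n + n) :=
  block_mx (transT a b x) 0 0 (invmx (transT a b x))^T.

(* Families of component functions: the value at a and x is only meaningful for
   x in cimg a. *)
Definition components (T : Type) := chart A -> 'cV[R]_n -> T.

Definition everywhere (P : chart A -> 'cV[R]_n -> Prop) : Prop :=
  forall a x, cimg a x -> P a x.

Section Bundle.
Context (m : nat) (g : chart A -> chart A -> 'cV[R]_n -> 'M[R]_m).

Definition smooth_section (X : components 'cV[R]_m) : Prop :=
  (forall a, smooth_mx (cimg a) (X a)) /\
  (forall a b x, coverlap a b x -> X b (ctrans a b x) = g a b x *m X a x).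

Definition smooth_complex_section (Z : components 'cV[R[i]]_m) : Prop :=
  smooth_section (fun a => re_field (Z a)) /\
  smooth_section (fun a => im_field (Z a)).

Definition smooth_endo (S : components 'M[R]_m) : Prop :=
  (forall a, smooth_mx (cimg a) (S a)) /\
  (forall a b x, coverlap a b x ->
     S b (ctrans a b x) *m g a b x = g a b x *m S a x).

Definition in_eigenbundle (S : components 'M[R]_m) (e : R)
    (X : components 'cV[R]_m) : Prop :=
  everywhere (fun a x => S a x *m X a x = e *: X a x).

Definition in_complex_eigenbundle (S : components 'M[R]_m) (e : R[i])
    (Z : components 'cV[R[i]]_m) : Prop :=
  everywhere (fun a x => complexify (S a x) *m Z a x = e *: Z a x).

Variable B : ('cV[R]_n -> 'cV[R]_m) -> ('cV[R]_n -> 'cV[R]_m) ->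
             'cV[R]_n -> 'cV[R]_m.

Definition closed_eigenbundle (S : components 'M[R]_m) (e : R) : Prop :=
  forall X Y, smooth_section X -> smooth_section Y ->
    in_eigenbundle S e X -> in_eigenbundle S e Y ->
    in_eigenbundle S e (fun a => B (X a) (Y a)).

Definition closed_complex_eigenbundle (S : components 'M[R]_m) (e : R[i]) :
    Prop :=
  forall Z W, smooth_complex_section Z -> smooth_complex_section W ->
    in_complex_eigenbundle S e Z -> in_complex_eigenbundle S e W ->
    in_complex_eigenbundle S e (fun a => C_bilinear_ext B (Z a) (W a)).

End Bundle.

(* Every point lies in an integral manifold.  The latter is given, inside the
   domain of a chart, by an injective immersion f of an open subset V of R^k
   whose tangent spaces are the fibres of D. *)
Definition integrable_distribution (D : chart A -> 'cV[R]_n -> set 'cV[R]_n) :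
    Prop :=
  everywhere (fun a x =>
    exists k (V : set 'cV[R]_k) (f : 'cV[R]_k -> 'cV[R]_n),
      [/\ open V /\ smooth_mx V f,
          V 0 /\ f 0 = x,
          f @` V `<=` cimg a,
          (forall y z, V y -> V z -> f y = f z -> y = z) &
          forall y, V y -> \rank (jac f y) = k /\
            D a (f y) = [set jac f y *m w | w in [set: 'cV[R]_k]]]).

Definition eigendistribution (r : components 'M[R]_n) (e : R)
    (a : chart A) (x : 'cV[R]_n) : set 'cV[R]_n :=
  [set v | r a x *m v = e *: v].

Definition complex_structure (j : components 'M[R]_n) : Prop :=
  [/\ smooth_endo transT j,
      everywhere (fun a x => j a x *m j a x = - 1%:M),
      closed_complex_eigenbundle transT lie_bracket j 'i%C &
      closed_complex_eigenbundle transT lie_bracket j (- 'i%C)].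

Definition paracomplex_structure (r : components 'M[R]_n) : Prop :=
  [/\ smooth_endo transT r,
      everywhere (fun a x => r a x *m r a x = 1%:M),
      integrable_distribution (eigendistribution r 1),
      integrable_distribution (eigendistribution r (-1)) &
      everywhere (fun a x => \rank (col_eigenspace (r a x) 1)
                             = \rank (col_eigenspace (r a x) (-1)))].

Definition symplectic_form (w : components 'M[R]_n) : Prop :=
  [/\ (forall a, smooth_mx (cimg a) (w a)) /\
      (forall a b x, coverlap a b x -> forall u v,
         bil (w b (ctrans a b x)) (transT a b x *m u) (transT a b x *m v)
         = bil (w a x) u v),
      everywhere (fun a x => forall u v, bil (w a x) u v = - bil (w a x) v u),
      everywhere (fun a x => forall u, (forall v, bil (w a x) u v = 0) -> u = 0)
    & everywhere (fun a x => forall i k l,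
        pd i (fun y => w a y k l) x + pd k (fun y => w a y l i) x
        + pd l (fun y => w a y i k) x = 0)].

Definition anticommute m (S J : components 'M[R]_m) : Prop :=
  everywhere (fun a x => S a x *m J a x = - (J a x *m S a x)).

Definition integrable_l0_structure (lambda : sign) (j r : components 'M[R]_n) :
    Prop :=
  match lambda with
  | Plus => paracomplex_structure r
  | Minus => complex_structure r
  end /\ anticommute r j.

Definition plus_integrable_10_structure (j r : components 'M[R]_n) : Prop :=
  [/\ smooth_endo transT r,
      everywhere (fun a x => r a x *m r a x = 1%:M),
      anticommute r j &
      integrable_distribution (eigendistribution r 1)].

Definition integrable_0l_structure (l : sign) (j w : components 'M[R]_n) :
    Prop :=
  symplectic_form w /\
  everywhere (fun a x => forall u v,
    match l with
    | Plus => bil (w a x) (j a x *m u) v = - bil (w a x) u (j a x *m v)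
    | Minus => bil (w a x) (j a x *m u) v = bil (w a x) u (j a x *m v)
    end).

Definition skew_split_section (lambda : sign) (S : components 'M[R]_(n + n)) :
    Prop :=
  [/\ smooth_endo transTT S,
      everywhere (fun a x => S a x *m S a x = (sval_sign R lambda)%:M),
      everywhere (fun a x => match lambda with
        | Plus => two_equal_eigenspaces (S a x)
        | Minus => two_equal_eigenspaces (complexify (S a x))
        end) &
      everywhere (fun a x => forall X Y,
        split_form (S a x *m X) Y = - split_form X (S a x *m Y))].

Definition generalized_complex_structure (S : components 'M[R]_(n + n)) : Prop :=
  [/\ skew_split_section Minus S,
      closed_complex_eigenbundle transTT courant_bracket S 'i%C &
      closed_complex_eigenbundle transTT courant_bracket S (- 'i%C)].

Definition generalized_paracomplex_structure (S : components 'M[R]_(n + n)) :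
    Prop :=
  [/\ skew_split_section Plus S,
      closed_eigenbundle transTT courant_bracket S 1 &
      closed_eigenbundle transTT courant_bracket S (-1)].

Definition plus_generalized_paracomplex_structure
    (S : components 'M[R]_(n + n)) : Prop :=
  skew_split_section Plus S /\
  closed_eigenbundle transTT courant_bracket S 1.

(* The dual map j^* on covectors has matrix j^T. *)
Definition J_l (l : sign) (j : components 'M[R]_n) : components 'M[R]_(n + n) :=
  fun a x => block_mx (j a x) 0 0 (sval_sign R l *: (j a x)^T).

Definition integrable_structure (lambda l : sign) (j : components 'M[R]_n)
    (S : components 'M[R]_(n + n)) : Prop :=
  match lambda with
  | Plus => generalized_paracomplex_structure S
  | Minus => generalized_complex_structure S
  end /\ anticommute S (J_l l j).

Definition plus_integrable_structure (l : sign) (j : components 'M[R]_n)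
    (S : components 'M[R]_(n + n)) : Prop :=
  plus_generalized_paracomplex_structure S /\ anticommute S (J_l l j).

Definition diag_block (r t : components 'M[R]_n) : components 'M[R]_(n + n) :=
  fun a x => block_mx (r a x) 0 0 (t a x).

Definition antidiag_block (p w : components 'M[R]_n) :
    components 'M[R]_(n + n) :=
  fun a x => block_mx 0 (p a x) (flat (w a x)) 0.

End Geometry.

(* Main.v *)
(* A block-diagonal structure restricts to TM, and there closedness for the
   Courant bracket becomes closedness of the eigenbundles of r for the Lie
   bracket; a block-antidiagonal structure is the graph of omega^flat over TM
   (or its complexification), and the bracket of two sections of this graph lies
   in the graph only if d omega = 0.  As j anticommutes with r, it exchanges
   the two eigendistributions of r, so that these have constant rank.

   The analytic part is the passage from involutivity to integral manifolds.
   Near a point, a distribution of rank k given by an involutive projector field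
   P has a frame B = (B_1 ... B_k) of commuting vector fields, and one has to
   solve df = B(f), f(0) = x.  Put f(y) = z_y(1), where z_y is the solution of
   z' = B(z) y, z(0) = x.  The curve z_y(s) + s B(z_y(s)) h solves the equation
   for y + h up to an error O(|h|^2), because the fields B_i commute; hence
   f(y + h) = f(y) + B(f(y)) h + O(|h|^2), without any appeal to the
   differentiable dependence of solutions on parameters.  Smoothness of f follows
   by bootstrapping. *)
Require Import Defs.
From mathcomp Require Import all_boot all_order all_algebra.
From mathcomp Require Import all_classical all_reals all_analysis.
From mathcomp Require Import complex ring lra.

Set Implicit Arguments.
Unset Strict Implicit.
Unset Printing Implicit Defensive.

Import Order.TTheory GRing.Theory Num.Theory numFieldNormedType.Exports.

Local Open Scope classical_set_scope.
Local Open Scope ring_scope.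

(** * Smooth functions *)

Section PartialDerivatives.
Context {R : realType}.

(** Closedness of an eigenbundle speaks of global sections, whereas involutivity and [d omega = 0]
    are conditions at a point of a chart. Test sections bridge the gap: a vector at a point extends,
    by a bump function, to a global field whose Jacobian vanishes at that point. There the field
    differentiates like a constant one, so the brackets of its images under a projector [P], or of
    its lifts to the graph of [F = flat w], contain first derivatives of [P] or [F] and nothing
    else. These are exactly the pointwise expressions to be controlled.

    The definitions treat the two signs differently: complex structures are defined by closedness,
    paracomplex ones by integral manifolds, so the differential equations serve the real case. The
    form [omega] is obtained from one eigenbundle, for the eigenvalue [1] or [-i], so that the graph
    argument is common to both parts of the theorem; [l] enters through the anticommutation with
    [J_l]. *)

Lemma matrix_delta_sum (V : Type) p q (F : V -> 'M[R]_(p, q)) :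
  F = fun x => \sum_(i < p) \sum_(j < q) F x i j *: delta_mx i j.
Proof. by apply/funext => x; exact: matrix_sum_delta. Qed.

Lemma differentiable_mx (V : normedModType R) p q (F : V -> 'M[R]_(p, q)) x :
  (forall i j, differentiable (fun y => F y i j) x) -> differentiable F x.
Proof.
move=> dF; rewrite (matrix_delta_sum F).
have -> : (fun x => \sum_(i < p) \sum_(j < q) F x i j *: delta_mx i j) =
  \sum_(i < p) \sum_(j < q) (fun x => F x i j *: (delta_mx i j : 'M[R]_(p, q))).
  apply/funext => y; rewrite fct_sumE; apply: eq_bigr => i _.
  by rewrite fct_sumE.
apply: differentiable_sum => i; apply: differentiable_sum => j.
exact: differentiableZl.
Qed.

Lemma diff_mxE (V : normedModType R) p q (F : V -> 'M[R]_(p, q)) x v i j :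
  (forall i j, differentiable (fun y => F y i j) x) ->
  'd F x v i j = 'd (fun y => F y i j) x v.
Proof.
move=> dF; have dF' := differentiable_mx dF.
rewrite -deriveE// derive_mx; last exact: diff_derivable.
by rewrite mxE deriveE.
Qed.

Lemma col_delta_sum n (v : 'cV[R]_n) : v = \sum_k v k 0 *: delta_mx k 0.
Proof.
rewrite {1}(matrix_sum_delta v); apply: eq_bigr => k _.
by rewrite big_ord1.
Qed.

Lemma diff_pd n (f : 'cV[R]_n -> R) x v : differentiable f x ->
  'd f x v = \sum_k pd k f x * v k 0.
Proof.
move=> df; rewrite {1}(col_delta_sum v) linear_sum; apply: eq_bigr => k _.
by rewrite linearZ /= /pd deriveE// mulrC.
Qed.

Lemma near_pd n (f g : 'cV[R]_n -> R) i x :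
  (\near x, f x = g x) -> pd i f x = pd i g x.
Proof. exact: near_eq_derive. Qed.

(** With a named candidate [L] and an explicit error bound, differentiability can be read off from
    estimates, as later for [flat_exp] at [0] and for maps with a quadratic error. *)
Lemma differentiable_epsP (V W : normedModType R) (f : V -> W) x :
  differentiable f x <-> exists2 L : {linear V -> W}, continuous L &
    forall e, 0 < e -> \forall h \near (0 : V),
      `|f (h + x) - (f x + L h)| <= e * `|h|.
Proof.
split=> [/diff_locallyP[cf /eqaddoP df]|[L cL HL]].
  by exists 'd f x.
have fL : f \o shift x = cst (f x) + L +o_ 0 id by exact/eqaddoP.
by apply/diff_locallyP; rewrite (diff_unique cL fL).
Qed.

Lemma diff_epsE (V W : normedModType R) (f : V -> W) x (L : {linear V -> W}) :
  continuous L ->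
  (forall e, 0 < e -> \forall h \near (0 : V),
      `|f (h + x) - (f x + L h)| <= e * `|h|) ->
  'd f x = L :> (V -> W).
Proof. by move=> cL HL; apply: diff_unique => //; exact/eqaddoP. Qed.

Lemma near_differentiable (V W : normedModType R) (f g : V -> W) x :
  (\near x, f x = g x) -> differentiable f x -> differentiable g x.
Proof.
move=> fg /differentiable_epsP[L cL HL]; apply/differentiable_epsP.
exists L => // e e0.
have : \forall h \near (0 : V), f (h + x) = g (h + x).
  by move: fg; rewrite (near_shift 0 x); apply: filterS => h /=; rewrite subr0.
move: (HL e e0); apply: filterS2 => h + <-.
by rewrite (nbhs_singleton fg).
Qed.

Lemma pd_cst n (c : R) i : pd i (fun _ : 'cV[R]_n => c) = fun=> 0.
Proof. by apply/funext => x; exact: derive_cst. Qed.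

Lemma pdD n (f g : 'cV[R]_n -> R) i x :
  differentiable f x -> differentiable g x ->
  pd i (fun y => f y + g y) x = pd i f x + pd i g x.
Proof. by move=> df dg; apply: deriveD; exact: diff_derivable. Qed.

Lemma pdN n (f : 'cV[R]_n -> R) i x :
  differentiable f x -> pd i (fun y => - f y) x = - pd i f x.
Proof. by move=> df; apply: deriveN; exact: diff_derivable. Qed.

Lemma pdM n (f g : 'cV[R]_n -> R) i x :
  differentiable f x -> differentiable g x ->
  pd i (fun y => f y * g y) x = pd i f x * g x + f x * pd i g x.
Proof.
move=> df dg; have := @deriveM _ _ f g x (delta_mx i 0)
  (diff_derivable df) (diff_derivable dg).
by rewrite /pd => ->; rewrite addrC mulrC.
Qed.

Lemma pd_sum n m (f : 'I_m -> 'cV[R]_n -> R) i x :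
  (forall k, differentiable (f k) x) ->
  pd i (fun y => \sum_k f k y) x = \sum_k pd i (f k) x.
Proof.
move=> df; have := @derive_sum _ _ _ _ f x (delta_mx i 0)
  (fun k => diff_derivable (df k)).
by rewrite /pd fct_sumE.
Qed.

Lemma differentiable_sumE n m (f : 'I_m -> 'cV[R]_n -> R) x :
  (forall k, differentiable (f k) x) ->
  differentiable (fun y => \sum_k f k y) x.
Proof.
move=> df; rewrite (_ : (fun y => _) = \sum_k f k); last by rewrite fct_sumE.
exact: differentiable_sum.
Qed.

Lemma pd_comp m n (f : 'cV[R]_n -> R) (g : 'cV[R]_m -> 'cV[R]_n) i x :
  differentiable f (g x) -> (forall k, differentiable (fun y => g y k 0) x) ->
  pd i (fun y => f (g y)) x =
  \sum_k pd k f (g x) * pd i (fun y => g y k 0) x.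
Proof.
move=> df dg.
have dg0 k j : differentiable (fun y => g y k j) x by rewrite (ord1 j).
have dg' := differentiable_mx dg0.
rewrite {1}/pd deriveE; last exact: differentiable_comp.
rewrite (_ : (fun y => f (g y)) = f \o g)// diff_comp//= diff_pd//.
by apply: eq_bigr => l _; congr (_ * _); rewrite diff_mxE// /pd deriveE.
Qed.


Lemma pd_coord n (k i : 'I_n) x :
  pd i (fun y : 'cV[R]_n => y k 0) x = (k == i)%:R.
Proof.
rewrite /pd deriveE; last exact: differentiable_coord.
have := @diff_mxE 'cV[R]_n n 1 id x (delta_mx i 0) k 0
  (fun i j => @differentiable_coord R _ _ x i j).
by rewrite diff_val => <-; rewrite mxE andbT.
Qed.

End PartialDerivatives.

Section SmoothFunctions.
Context {R : realType}.

Lemma diff_timesW n k (U : set 'cV[R]_n) f :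
  diff_times k.+1 U f -> diff_times k U f.
Proof.
elim: k f => [//|k IHk] f [df pf]; split=> // i.
by apply: IHk; exact: pf.
Qed.

Lemma diff_times_sub n k (U V : set 'cV[R]_n) f :
  V `<=` U -> diff_times k U f -> diff_times k V f.
Proof.
move=> VU; elim: k f => [//|k IHk] f [df pf].
by split=> [x /VU /df//|i]; exact/IHk/pf.
Qed.

(** Since [pd] is an unrestricted derivative, [diff_times] on a set is a conjunction of conditions
    at its points, and [V] may be any set through the point. Openness matters where [f] is replaced
    by a function that agrees with it on the set. *)
Lemma diff_times_local n k (U : set 'cV[R]_n) f :
  (forall x, U x -> exists2 V, V x & diff_times k V f) -> diff_times k U f.
Proof.
elim: k f => [//|k IHk] f Uf; split=> [x /Uf[V Vx [df _]]|i]; first exact: df.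
by apply: IHk => x /Uf[V Vx [_ pf]]; exists V => //; exact: pf.
Qed.

Lemma open_near_eq n (U : set 'cV[R]_n) T (f g : 'cV[R]_n -> T) x :
  open U -> (forall y, U y -> f y = g y) -> U x -> \near x, f x = g x.
Proof.
by move=> oU fg Ux; apply: filterS fg _; apply: open_nbhs_nbhs.
Qed.

Lemma diff_times_ext n k (U : set 'cV[R]_n) f g :
  open U -> (forall x, U x -> f x = g x) ->
  diff_times k U f -> diff_times k U g.
Proof.
move=> oU; elim: k f g => [//|k IHk] f g fg [df pf]; split=> [x Ux|i].
  by apply: near_differentiable (df _ Ux); exact: open_near_eq Ux.
apply: IHk (pf i) => x Ux; apply: near_pd; exact: open_near_eq Ux.
Qed.

Lemma smooth_onP n (U : set 'cV[R]_n) f : smooth_on U f <->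
  (forall x, U x -> differentiable f x) /\ (forall i, smooth_on U (pd i f)).
Proof.
split=> [sf|[df pf] [//|k]]; last by split=> // i; exact: pf.
by split=> [x Ux|i k]; [have [df _] := sf 1 | have [_ pf] := sf k.+1];
   [exact: df | exact: pf].
Qed.

Lemma smooth_on_differentiable n (U : set 'cV[R]_n) f x :
  smooth_on U f -> U x -> differentiable f x.
Proof. by move=> /smooth_onP[df _]; exact: df. Qed.

Lemma smooth_on_pd n (U : set 'cV[R]_n) f i :
  smooth_on U f -> smooth_on U (pd i f).
Proof. by move=> /smooth_onP[_ pf]; exact: pf. Qed.

Lemma smooth_on_sub n (U V : set 'cV[R]_n) f :
  V `<=` U -> smooth_on U f -> smooth_on V f.
Proof. by move=> VU sf k; exact: diff_times_sub (sf k). Qed.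

Lemma smooth_on_local n (U : set 'cV[R]_n) f :
  (forall x, U x -> exists2 V, V x & smooth_on V f) -> smooth_on U f.
Proof.
move=> Uf k; apply: diff_times_local => x /Uf[V Vx sf].
by exists V => //; exact: sf.
Qed.

Lemma smooth_on_ext n (U : set 'cV[R]_n) f g :
  open U -> (forall x, U x -> f x = g x) -> smooth_on U f -> smooth_on U g.
Proof. by move=> oU fg sf k; exact: diff_times_ext (sf k). Qed.

Lemma diff_times_cst n k (U : set 'cV[R]_n) (c : R) :
  diff_times k U (fun=> c).
Proof.
elim: k c => [//|k IHk] c; split=> [x _|i]; first exact: differentiable_cst.
by rewrite pd_cst; exact: IHk.
Qed.

Lemma smooth_on_cst n (U : set 'cV[R]_n) (c : R) : smooth_on U (fun=> c).
Proof. by move=> k; exact: diff_times_cst. Qed.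

Lemma smooth_on_coord n (U : set 'cV[R]_n) i : smooth_on U (fun x => x i 0).
Proof.
apply/smooth_onP; split=> [x _|k]; first exact: differentiable_coord.
rewrite (_ : pd k _ = fun=> (i == k)%:R); last by apply/funext => x; rewrite pd_coord.
exact: smooth_on_cst.
Qed.

Lemma diff_timesD n k (U : set 'cV[R]_n) f g : open U ->
  diff_times k U f -> diff_times k U g -> diff_times k U (fun x => f x + g x).
Proof.
move=> oU; elim: k f g => [//|k IHk] f g [df pf] [dg pg]; split=> [x Ux|i].
  by apply: differentiableD; [exact: df | exact: dg].
apply: diff_times_ext oU _ (IHk _ _ (pf i) (pg i)) => x Ux.
by rewrite pdD//; [exact: df | exact: dg].
Qed.

Lemma diff_timesM n k (U : set 'cV[R]_n) f g : open U ->
  diff_times k U f -> diff_times k U g -> diff_times k U (fun x => f x * g x).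
Proof.
move=> oU; elim: k f g => [//|k IHk] f g Hf Hg.
have [[df pf] [dg pg]] := (Hf, Hg).
split=> [x Ux|i]; first by apply: differentiableM; [exact: df | exact: dg].
apply: diff_times_ext oU _ (diff_timesD oU (IHk _ _ (pf i) (diff_timesW Hg))
  (IHk _ _ (diff_timesW Hf) (pg i))) => x Ux.
by rewrite pdM//; [exact: df | exact: dg].
Qed.

Lemma diff_times_sum n m k (U : set 'cV[R]_n) (f : 'I_m -> 'cV[R]_n -> R) :
  open U -> (forall j, diff_times k U (f j)) ->
  diff_times k U (fun x => \sum_j f j x).
Proof.
move=> oU Hf.
suff H s : diff_times k U (fun x => \sum_(j <- s) f j x) by exact: H.
elim: s => [|j s IHs].
  apply: diff_times_ext oU _ (diff_times_cst _ _ 0) => x _.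
  by rewrite big_nil.
apply: diff_times_ext oU _ (diff_timesD oU (Hf j) IHs) => x _.
by rewrite big_cons.
Qed.

Lemma diff_times_comp m n k (U : set 'cV[R]_n) (V : set 'cV[R]_m) f g :
  open V -> (forall x, V x -> U (g x)) -> diff_times k U f ->
  (forall j, diff_times k V (fun x => g x j 0)) ->
  diff_times k V (fun x => f (g x)).
Proof.
move=> oV VU; elim: k f => [//|k IHk] f Hf Hg.
have [df pf] := Hf.
have dg j x : V x -> differentiable (fun y => g y j 0) x.
  by have [d _] := Hg j; exact: d.
split=> [x Vx|i].
  apply: (@differentiable_comp _ _ _ _ g f); last exact/df/VU.
  by apply: differentiable_mx => j l; rewrite (ord1 l); exact: dg.
have H j : diff_times k V (fun x => pd j f (g x) * pd i (fun y => g y j 0) x).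
  apply: diff_timesM => //; last by have [_] := Hg j; exact.
  by apply: IHk (pf j) _ => l; exact: diff_timesW.
apply: diff_times_ext oV _ (diff_times_sum oV H) => x Vx.
rewrite pd_comp//; first exact/df/VU.
by move=> l; exact: dg.
Qed.

Lemma diff_timesV n k (U : set 'cV[R]_n) f : open U ->
  (forall x, U x -> f x != 0) ->
  diff_times k U f -> diff_times k U (fun x => (f x)^-1).
Proof.
move=> oU f0; elim: k => [//|k IHk] Hf; have [df pf] := Hf.
split=> [x Ux|i]; first by apply: differentiableV; [exact: df | exact: f0].
have IH := IHk (diff_timesW Hf).
(* The derivative of [1/f] is [- f' (1/f)^2], again an expression in [1/f], so the induction
   hypothesis is used twice. *)
apply: diff_times_ext oU _ (diff_timesM oU (diff_times_cst _ _ (-1))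
  (diff_timesM oU (pf i) (diff_timesM oU IH IH))) => x Ux.
have := @deriveV _ _ f x (delta_mx i 0) (f0 _ Ux) (diff_derivable (df _ Ux)).
rewrite /pd => ->; rewrite -exprVn /GRing.scale/=; ring.
Qed.

Lemma smooth_onD n (U : set 'cV[R]_n) f g : open U ->
  smooth_on U f -> smooth_on U g -> smooth_on U (fun x => f x + g x).
Proof. by move=> oU sf sg k; exact: diff_timesD. Qed.

Lemma smooth_onM n (U : set 'cV[R]_n) f g : open U ->
  smooth_on U f -> smooth_on U g -> smooth_on U (fun x => f x * g x).
Proof. by move=> oU sf sg k; exact: diff_timesM. Qed.

Lemma smooth_onZ n (U : set 'cV[R]_n) c f : open U ->
  smooth_on U f -> smooth_on U (fun x => c * f x).
Proof. by move=> oU sf; apply: smooth_onM => //; exact: smooth_on_cst. Qed.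

Lemma smooth_onN n (U : set 'cV[R]_n) f : open U ->
  smooth_on U f -> smooth_on U (fun x => - f x).
Proof.
move=> oU sf; apply: smooth_on_ext oU _ (smooth_onZ (-1) oU sf) => x _.
by rewrite mulN1r.
Qed.

Lemma smooth_on_sum n m (U : set 'cV[R]_n) (f : 'I_m -> 'cV[R]_n -> R) :
  open U -> (forall j, smooth_on U (f j)) -> smooth_on U (fun x => \sum_j f j x).
Proof. by move=> oU sf k; apply: diff_times_sum => // j; exact: sf. Qed.

Lemma smooth_on_comp m n (U : set 'cV[R]_n) (V : set 'cV[R]_m) f g :
  open V -> (forall x, V x -> U (g x)) -> smooth_on U f -> smooth_mx V g ->
  smooth_on V (fun x => f (g x)).
Proof.
move=> oV VU sf sg k; apply: diff_times_comp (sf k) _ => // j; exact: sg.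
Qed.

Lemma smooth_onV n (U : set 'cV[R]_n) f : open U ->
  (forall x, U x -> f x != 0) ->
  smooth_on U f -> smooth_on U (fun x => (f x)^-1).
Proof. by move=> oU f0 sf k; exact: diff_timesV. Qed.

Lemma smooth_mx_sub n p q (U V : set 'cV[R]_n) (F : _ -> 'M[R]_(p, q)) :
  V `<=` U -> smooth_mx U F -> smooth_mx V F.
Proof. by move=> VU sF i j; exact: smooth_on_sub (sF i j). Qed.

Lemma smooth_mx_ext n p q (U : set 'cV[R]_n) (F G : _ -> 'M[R]_(p, q)) :
  open U -> (forall x, U x -> F x = G x) -> smooth_mx U F -> smooth_mx U G.
Proof.
by move=> oU FG sF i j; apply: smooth_on_ext oU _ (sF i j) => x /FG ->.
Qed.

Lemma smooth_mx_comp m n p q (U : set 'cV[R]_n) (V : set 'cV[R]_m)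
    (F : _ -> 'M[R]_(p, q)) g :
  open V -> (forall x, V x -> U (g x)) -> smooth_mx U F -> smooth_mx V g ->
  smooth_mx V (fun x => F (g x)).
Proof. by move=> oV VU sF sg i j; exact: smooth_on_comp (sF i j) sg. Qed.

Lemma smooth_mx_cst n p q (U : set 'cV[R]_n) (C : 'M[R]_(p, q)) :
  smooth_mx U (fun=> C).
Proof. by move=> i j; exact: smooth_on_cst. Qed.

Lemma smooth_mxD n p q (U : set 'cV[R]_n) (F G : _ -> 'M[R]_(p, q)) :
  open U -> smooth_mx U F -> smooth_mx U G -> smooth_mx U (fun x => F x + G x).
Proof.
move=> oU sF sG i j; apply: smooth_on_ext oU _ (smooth_onD oU (sF i j) (sG i j)).
by move=> x _; rewrite mxE.
Qed.

Lemma smooth_mxZ n p q (U : set 'cV[R]_n) f (F : _ -> 'M[R]_(p, q)) :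
  open U -> smooth_on U f -> smooth_mx U F -> smooth_mx U (fun x => f x *: F x).
Proof.
move=> oU sf sF i j; apply: smooth_on_ext oU _ (smooth_onM oU sf (sF i j)).
by move=> x _; rewrite mxE.
Qed.

Lemma smooth_mxM n p q r (U : set 'cV[R]_n) (F : _ -> 'M[R]_(p, q))
    (G : _ -> 'M[R]_(q, r)) :
  open U -> smooth_mx U F -> smooth_mx U G -> smooth_mx U (fun x => F x *m G x).
Proof.
move=> oU sF sG i j; apply: smooth_on_ext oU _ (smooth_on_sum oU
  (fun k => smooth_onM oU (sF i k) (sG k j))) => x _.
by rewrite mxE.
Qed.

Lemma smooth_det n p (U : set 'cV[R]_n) (F : _ -> 'M[R]_p) :
  open U -> smooth_mx U F -> smooth_on U (fun x => \det (F x)).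
Proof.
move=> oU; elim: p F => [|p IHp] F sF.
  apply: smooth_on_ext oU _ (smooth_on_cst _ 1) => x _.
  by rewrite det_mx00.
have sminor j : smooth_on U (fun x => \det (row' ord0 (col' j (F x)))).
  apply: IHp => i k; apply: smooth_on_ext oU _ (sF (lift ord0 i) (lift j k)).
  by move=> x _; rewrite !mxE.
apply: smooth_on_ext oU _ (smooth_on_sum oU (fun j => smooth_onM oU (sF ord0 j)
  (smooth_onZ ((-1) ^+ (@ord0 p + j)%N) oU (sminor j)))) => x _.
by rewrite (expand_det_row _ ord0).
Qed.

Lemma smooth_invmx n p (U : set 'cV[R]_n) (F : _ -> 'M[R]_p) :
  open U -> (forall x, U x -> F x \in unitmx) -> smooth_mx U F ->
  smooth_mx U (fun x => invmx (F x)).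
Proof.
move=> oU uF sF.
have sadj : smooth_mx U (fun x => \adj (F x)).
  move=> i j.
  have sminor : smooth_on U (fun x => \det (row' j (col' i (F x)))).
    apply: smooth_det => // k l.
    apply: smooth_on_ext oU _ (sF (lift j k) (lift i l)) => x _.
    by rewrite !mxE.
  apply: smooth_on_ext oU _ (smooth_onZ ((-1) ^+ (j + i)%N) oU sminor) => x _.
  by rewrite mxE.
apply: smooth_mx_ext oU _ (smooth_mxZ oU (smooth_onV oU _ (smooth_det oU sF)) sadj).
  by move=> x /uF Fx; rewrite /invmx Fx.
by move=> x /uF; rewrite unitmxE unitfE.
Qed.

Lemma smooth_jac m n (U : set 'cV[R]_n) (F : _ -> 'cV[R]_m) :
  open U -> smooth_mx U F -> smooth_mx U (jac F).
Proof.
move=> oU sF i j; apply: smooth_on_ext oU _ (smooth_on_pd j (sF i 0)) => x _.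
by rewrite mxE.
Qed.

Lemma jac_comp m n p (F : 'cV[R]_n -> 'cV[R]_p) (g : 'cV[R]_m -> 'cV[R]_n) x :
  (forall k, differentiable (fun y => F y k 0) (g x)) ->
  (forall k, differentiable (fun y => g y k 0) x) ->
  jac (fun y => F (g y)) x = jac F (g x) *m jac g x.
Proof.
move=> dF dg; apply/matrixP => i j; rewrite !mxE.
rewrite (@pd_comp _ _ _ (fun y => F y i 0))//.
by apply: eq_bigr => k _; rewrite !mxE.
Qed.

Lemma near_jac m n (F G : 'cV[R]_n -> 'cV[R]_m) x :
  (\near x, F x = G x) -> jac F x = jac G x.
Proof.
move=> FG; apply/matrixP => i j; rewrite !mxE; apply: near_pd.
by apply: filterS FG => y ->.
Qed.

End SmoothFunctions.

(** * Ordinary differential equations *)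

Section MatrixNorm.
Context {R : realType}.

Lemma mx_norm_leP p q (A : 'M[R]_(p, q)) c : 0 <= c ->
  `|A| <= c <-> forall i j, `|A i j| <= c.
Proof.
move=> c0; rewrite {1}/Num.Def.normr/= mx_normrE; split=> [H i j|H].
  exact: le_trans (le_bigmax _ (fun ij => `|A ij.1 ij.2|) (i, j)) H.
by apply: bigmax_le => // -[i j] _.
Qed.

Lemma le_mx_norm p q (A : 'M[R]_(p, q)) i j : `|A i j| <= `|A|.
Proof. exact: (mx_norm_leP A (normr_ge0 A)).1. Qed.

Lemma mulmx_norm p q r (A : 'M[R]_(p, q)) (B : 'M[R]_(q, r)) :
  `|A *m B| <= q%:R * `|A| * `|B|.
Proof.
apply/mx_norm_leP => [|i j]; first by rewrite !mulr_ge0.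
rewrite mxE (le_trans (ler_norm_sum _ _ _))//.
rewrite -mulrA mulr_natl -[q in _ *+ q]card_ord -sumr_const ler_sum// => k _.
by rewrite normrM ler_pM// le_mx_norm.
Qed.

End MatrixNorm.

Section Curves.
Context {R : realType}.

Lemma mvt_bound (f df : R -> R) (a b c : R) : a <= b ->
  (forall s, a <= s <= b -> is_derive s 1 f (df s)) ->
  (forall s, a <= s <= b -> `|df s| <= c) -> `|f b - f a| <= c * (b - a).
Proof.
move=> ab fd fc.
have cf : {within `[a, b], continuous f}.
  apply: derivable_within_continuous => s; rewrite in_itv/= => sab.
  by have [] := fd s sab.
have [s|s sab ->] := @MVT_segment R f df a b ab _ cf.
  by rewrite in_itv/= => /andP[/ltW ? /ltW ?]; apply: fd; apply/andP.
rewrite normrM (ger0_norm (x := b - a)) ?subr_ge0// ler_wpM2r ?subr_ge0//.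
by apply: fc; move: sab; rewrite in_itv.
Qed.

(** The open interval contains [[0, 1]], so that two-sided derivatives are available at both of its
    ends. *)
Definition curve_derive n (z dz : R -> 'cV[R]_n) :=
  forall s : R, -1 < s < 2 -> forall i, is_derive s 1 (fun t => z t i 0) (dz s i 0).

Lemma curve_bound n (z dz : R -> 'cV[R]_n) (a b c : R) : a <= b -> 0 <= c ->
  (forall s : R, a <= s <= b -> forall i, is_derive s 1 (fun t => z t i 0) (dz s i 0)) ->
  (forall s, a <= s <= b -> `|dz s| <= c) -> `|z b - z a| <= c * (b - a).
Proof.
move=> ab c0 zd zc; apply/mx_norm_leP => [|i j].
  by rewrite mulr_ge0// subr_ge0.
rewrite (ord1 j) !mxE.
apply: (@mvt_bound (fun t => z t i 0) (fun t => dz t i 0)) => // s sab.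
  exact: zd.
exact: le_trans (le_mx_norm _ _ _) (zc _ sab).
Qed.

Lemma is_derive_curve n (f : 'cV[R]_n -> R) (z dz : R -> 'cV[R]_n) (s : R) :
  differentiable f (z s) ->
  (forall i, is_derive s 1 (fun t => z t i 0) (dz s i 0)) ->
  is_derive s 1 (fun t => f (z t)) (\sum_k pd k f (z s) * dz s k 0).
Proof.
move=> df zd.
have dz0 k j : differentiable (fun t => z t k j) s.
  by rewrite (ord1 j); apply/derivable1_diffP; have [] := zd k.
have dz' := differentiable_mx dz0.
have dfz : differentiable (f \o z) s by exact: differentiable_comp.
apply: DeriveDef; first exact: diff_derivable.
rewrite deriveE// (_ : (fun t => f (z t)) = f \o z)// diff_comp//= diff_pd//.
apply: eq_bigr => k _; congr (_ * _); rewrite diff_mxE// -deriveE//.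
by have [_ <-] := zd k.
Qed.


Lemma geometric_limit (u : nat -> R) (C : R) :
  (forall m, `|u m.+1 - u m| <= C / 2 ^+ m) ->
  exists l, forall m, `|u m - l| <= 2 * C / 2 ^+ m.
Proof.
move=> uC.
have C0 : 0 <= C by have := le_trans (normr_ge0 _) (uC 0); rewrite expr0 divr1.
have cu : cvgn u.
  suff : cvgn (series (telescope u)).
    move=> /cvg_ex[/= l ul]; apply/cvg_ex; exists (u 0%N + l).
    have uE : u = cst (u 0%N) + series (telescope u).
      by apply/funext => n; exact: eq_sum_telescope.
    have : (cst (u 0%N) + series (telescope u)) @ \oo --> u 0%N + l.
      by apply: cvgD ul; exact: cvg_cst.
    by rewrite -uE.
  apply: normed_cvg; apply: (@series_le_cvg _ _ (geometric C 2^-1)) => [m|m|m|].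
  - exact: normr_ge0.
  - by rewrite /= mulr_ge0// exprn_ge0.
  - by rewrite /= exprVn; exact: uC.
  - by apply: is_cvg_geometric_series; rewrite ger0_norm// invf_lt1// ltr1n.
(* Subtracting the tail beyond [m + k] is what makes the bound pass through the induction on [k]. *)
have uk m k : `|u m - u (m + k)%N| <= 2 * C / 2 ^+ m - 2 * C / 2 ^+ (m + k).
  elim: k => [|k IHk]; first by rewrite addn0 !subrr normr0.
  rewrite -(subrKA (u (m + k)%N)) (le_trans (ler_normD _ _))//.
  have := uC (m + k)%N; rewrite distrC -addnS => /(lerD IHk) /le_trans; apply.
  rewrite addnS exprS invfM; lra.
exists (limn u) => m; apply/ler_addgt0Pr => e e0.
have /cvgrPdist_le/(_ e e0)[N _ HN] := cu.
rewrite -(subrKA (u (m + N)%N)) (le_trans (ler_normD _ _))// lerD//.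
  apply: le_trans (uk m N) _; rewrite lerBlDr lerDl.
  by rewrite mulr_ge0 ?mulr_ge0// invr_ge0 exprn_ge0.
by rewrite distrC; apply: HN => /=; rewrite leq_addl.
Qed.

Lemma geometric_limit_col n (u : nat -> 'cV[R]_n) (C : R) :
  (forall m, `|u m.+1 - u m| <= C / 2 ^+ m) ->
  exists l, forall m, `|u m - l| <= 2 * C / 2 ^+ m.
Proof.
move=> uC.
have C0 : 0 <= C by have := le_trans (normr_ge0 _) (uC 0); rewrite expr0 divr1.
have ui i m : `|u m.+1 i 0 - u m i 0| <= C / 2 ^+ m.
  by have := le_trans (le_mx_norm _ i 0) (uC m); rewrite !mxE.
have [l ul] := choice (fun i => geometric_limit (ui i)).
exists (\col_i l i) => m; apply/mx_norm_leP => [|i j].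
  by rewrite divr_ge0 ?mulr_ge0// exprn_ge0.
by rewrite (ord1 j) !mxE.
Qed.

(** The integral over a segment is unsigned. A primitive valid on both sides of [0] therefore starts
    at [-2], to the left of [[-1, 2]], and is then normalized to vanish at [0]. *)
Definition primitive (g : R -> R) (s : R) : R :=
  \int[lebesgue_measure]_(t in `[-2, s]) g t
  - \int[lebesgue_measure]_(t in `[-2, 0]) g t.

Lemma primitive0 g : primitive g 0 = 0.
Proof. by rewrite /primitive subrr. Qed.

Lemma is_derive_primitive (g : R -> R) (s : R) :
  continuous g -> -2 < s -> is_derive s 1 (primitive g) (g s).
Proof.
move=> cg s2; rewrite /primitive.
have [] := @continuous_FTC1_closed R g (-2) s (s + 1) _ _ _ (cg s).
- by rewrite ltrDl.
- apply: continuous_compact_integrable; first exact: segment_compact.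
  by apply: continuous_subspaceT.
- exact: s2.
move=> dF dFs.
rewrite -[g s]subr0; apply: is_deriveB; apply: DeriveDef => //.
by rewrite -derive1E.
Qed.

Lemma le_geometric (a b c : R) : (forall m, a <= b + c / 2 ^+ m) -> a <= b.
Proof.
move=> abc; apply/ler_addgt0Pr => e e0.
have half1 : `|2^-1 : R| < 1 by rewrite ger0_norm// invf_lt1// ltr1n.
have /cvgrPdist_le/(_ e e0)[N _ HN] := cvg_geometric c half1.
apply: le_trans (abc N) _; rewrite lerD2l.
have := HN N (leqnn N); rewrite sub0r normrN /= exprVn.
by apply: le_trans; exact: ler_norm.
Qed.

Lemma curve_lipschitz n (z dz : R -> 'cV[R]_n) (c : R) : 0 <= c ->
  (forall s : R, -1 <= s <= 2 ->
     forall i, is_derive s 1 (fun t => z t i 0) (dz s i 0)) ->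
  (forall s, -1 <= s <= 2 -> `|dz s| <= c) ->
  forall s t, -1 <= s <= 2 -> -1 <= t <= 2 -> `|z s - z t| <= c * `|s - t|.
Proof.
move=> c0 zd zc.
suff H s t : -1 <= s <= 2 -> -1 <= t <= 2 -> t <= s -> `|z s - z t| <= c * `|s - t|.
  move=> s t Hs Ht; have [ts|/ltW st] := leP t s; first exact: H.
  by rewrite distrC (distrC s); exact: H.
move=> /andP[s1 s2] /andP[t1 t2] ts; rewrite (ger0_norm (x := s - t)) ?subr_ge0//.
apply: (@curve_bound _ z dz) => // u /andP[tu us].
  by apply: zd; rewrite (le_trans t1 tu) (le_trans us s2).
by apply: zc; rewrite (le_trans t1 tu) (le_trans us s2).
Qed.

Lemma lipschitz_continuous (V W : normedModType R) (f : V -> W) (c : R) :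
  (forall p q, `|f p - f q| <= c * `|p - q|) -> continuous f.
Proof.
move=> fc p; apply/cvgrPdist_le => e e0.
have c1 : 0 < `|c| + 1 by rewrite ltr_wpDl.
apply/nbhs_ballP; exists (e / (`|c| + 1)) => /=; first exact: divr_gt0.
move=> q; rewrite -ball_normE /= => /ltW; rewrite ler_pdivlMr// => H.
apply: le_trans (fc p q) _; apply: le_trans _ H.
rewrite mulrC ler_wpM2l//; apply: le_trans (ler_norm _) _; lra.
Qed.

(** The nearest-point retraction onto [[a, b]]. Being 1-Lipschitz, it extends maps from a segment,
    or coordinatewise from a box, without worsening a Lipschitz constant. *)
Definition clamp (a b s : R) : R :=
  if s < a then a else if s <= b then s else b.

Lemma clamp_bound a b s : a <= b -> a <= clamp a b s <= b.
Proof.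
move=> ab; rewrite /clamp; case: (ltP s a) => ?; first by apply/andP; split.
by case: (leP s b) => ?; apply/andP; split=> //; lra.
Qed.

Lemma clamp_id a b s : a <= s <= b -> clamp a b s = s.
Proof. by case/andP => s1 s2; rewrite /clamp s2 ltNge s1. Qed.

Lemma clamp_contract a b s t : a <= b ->
  `|clamp a b s - clamp a b t| <= `|s - t|.
Proof.
move=> ab; have [H1 H2] : s - t <= `|s - t| /\ t - s <= `|s - t|.
  by rewrite ler_norm distrC ler_norm.
rewrite /clamp ler_norml.
by case: (ltP s a) => ?; case: (ltP t a) => ?; case: (leP s b) => ?;
  case: (leP t b) => ?; apply/andP; split; lra.
Qed.

Section Picard.
Context {n : nat} (G : 'cV[R]_n -> 'cV[R]_n) (C : R) (x : 'cV[R]_n).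
Hypothesis G_contract : forall p q, `|G p - G q| <= 4^-1 * `|p - q|.
Hypothesis G_bound : forall p, `|G p| <= C.

Let C0 : 0 <= C. Proof. exact: le_trans (normr_ge0 _) (G_bound 0). Qed.

Let m12 : (-1 : R) <= 2. Proof. lra. Qed.

Let P (g : R -> 'cV[R]_n) (s : R) : 'cV[R]_n :=
  \col_i primitive (fun t => g t i 0) s.

Let P_derive (g : R -> 'cV[R]_n) (s : R) i : continuous g -> -2 < s ->
  is_derive s 1 (fun t => P g t i 0) (g s i 0).
Proof.
move=> cg s2; rewrite (_ : (fun t => _) = primitive (fun t => g t i 0)).
  apply: (@is_derive_primitive (fun t => g t i 0)) => // t.
  by apply: (@continuous_comp _ _ _ g (fun M : 'cV[R]_n => M i 0));
    [exact: cg | exact: coord_continuous].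
by apply/funext => t; rewrite mxE.
Qed.

(** The Picard operator. Clamping the time makes each [T z] Lipschitz on the whole line, so all
    iterates are continuous and are compared uniformly in [s]. As the clamped time is at most [2] in
    absolute value, the constant [1/4] for [G] makes [T] halve distances. *)
Let T (z : R -> 'cV[R]_n) (s : R) := x + P (G \o z) (clamp (-1) 2 s).

Let cG (z : R -> 'cV[R]_n) : continuous z -> continuous (G \o z).
Proof.
move=> cz s; apply: continuous_comp; first exact: cz.
exact: (lipschitz_continuous G_contract).
Qed.

Let T_lipschitz (z : R -> 'cV[R]_n) : continuous z ->
  forall s t, `|T z s - T z t| <= C * `|s - t|.
Proof.
move=> cz s t; rewrite /T opprD addrACA subrr add0r.
apply: (@le_trans _ _ (C * `|clamp (-1) 2 s - clamp (-1) 2 t|)); last first.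
  by rewrite ler_wpM2l// clamp_contract.
apply: (@curve_lipschitz _ _ (G \o z)); rewrite ?(clamp_bound _ m12)// => u;
  last by move=> _; exact: G_bound.
move=> /andP[u1 u2] i.
by apply: P_derive; [exact: cG | lra].
Qed.

Let P0 g : P g 0 = 0.
Proof. by apply/matrixP => i j; rewrite !mxE primitive0. Qed.

Let T_contract (z z' : R -> 'cV[R]_n) (c : R) : continuous z -> continuous z' ->
  (forall s, `|z s - z' s| <= c) -> forall s, `|T z s - T z' s| <= c / 2.
Proof.
move=> cz cz' zc s; rewrite /T opprD addrACA subrr add0r.
have c0 : 0 <= c := le_trans (normr_ge0 _) (zc 0).
(* Both primitives vanish at [0], so a Lipschitz estimate between the clamped time and [0] bounds
   their difference. *)
have -> : P (G \o z) (clamp (-1) 2 s) - P (G \o z') (clamp (-1) 2 s) =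
  (P (G \o z) (clamp (-1) 2 s) - P (G \o z') (clamp (-1) 2 s)) - (P (G \o z) 0 - P (G \o z') 0).
  by rewrite !P0 !subr0.
have /andP[s1 s2] := clamp_bound s m12.
have := @curve_lipschitz _ (fun t => P (G \o z) t - P (G \o z') t)
  (fun t => G (z t) - G (z' t)) (c / 4).
have h0 : (-1 <= (0 : R) <= 2) by apply/andP; split; lra.
move=> /(_ _ _ _ (clamp (-1) 2 s) 0 (clamp_bound s m12) h0) H; apply: le_trans (H _ _ _) _.
- by rewrite divr_ge0.
- move=> {}t /andP[t1 t2] i.
  rewrite (_ : (fun t => _) = fun t => P (G \o z) t i 0 - P (G \o z') t i 0); last first.
    by apply/funext => v; rewrite !mxE.
  by rewrite !mxE; apply: is_deriveB; apply: P_derive; [exact: cG|lra|exact: cG|lra].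
- move=> t _; apply: le_trans (G_contract _ _) _.
  by rewrite mulrC ler_wpM2r.
rewrite subr0; have : `|clamp (-1) 2 s| <= 2 by rewrite ler_norml; apply/andP; split; lra.
nra.
Qed.

Let u m := iter m T (cst x).

Let u_continuous m : continuous (u m).
Proof.
case: m => [|m]; first by move=> s; exact: cvg_cst.
elim: m => [|m IHm]; apply: lipschitz_continuous (T_lipschitz _) => //.
by move=> s; exact: cvg_cst.
Qed.

Let u_step m s : `|u m.+1 s - u m s| <= (2 * C) / 2 ^+ m.
Proof.
elim: m s => [|m IHm] s; last first.
  have -> : u m.+2 s - u m.+1 s = T (u m.+1) s - T (u m) s by [].
  apply: le_trans (T_contract (@u_continuous m.+1) (@u_continuous m) IHm s) _.
  by rewrite exprS invfM mulrCA mulrC.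
rewrite expr0 divr1.
have -> : u 0 s = T (cst x) 0.
  by rewrite /u /= /T clamp_id ?P0 ?addr0//; lra.
have /andP[s1 s2] := clamp_bound s m12.
have -> : u 1 s = T (cst x) (clamp (-1) 2 s).
  by rewrite /u /= /T (clamp_id (clamp_bound s m12)).
apply: le_trans (T_lipschitz _ _ _) _; first by move=> t; exact: cvg_cst.
rewrite subr0 mulrC ler_wpM2r// ler_norml; lra.
Qed.

Theorem picard :
  exists2 z : R -> 'cV[R]_n, z 0 = x & curve_derive z (fun s => G (z s)).
Proof.
have [z uz] := choice (fun s =>
  @geometric_limit_col n (fun m => u m s) (2 * C) (fun m => u_step m s)).
(* The limit inherits the Lipschitz constant of the iterates, hence is continuous and may be fed to
   [T]. The [4 C] is twice the error [4 C / 2^(m+1)] of the iterate of index [m + 1]. *)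
have zlip s t : `|z s - z t| <= C * `|s - t|.
  apply: (@le_geometric _ _ (4 * C)) => m.
  have -> : z s - z t =
     (u m.+1 s - u m.+1 t) + ((u m.+1 t - z t) - (u m.+1 s - z s)).
    by apply/matrixP => i j; rewrite !mxE; ring.
  apply: le_trans (ler_normD _ _) _.
  apply: lerD; first exact: (T_lipschitz (@u_continuous m)).
  apply: le_trans (ler_normB _ _) _.
  have := lerD (uz t m.+1) (uz s m.+1) => /le_trans; apply.
  by rewrite exprS invfM; lra.
have cz : continuous z := lipschitz_continuous zlip.
have Tz s : z s = T z s.
  apply/eqP; rewrite -subr_eq0 -normr_le0.
  apply: (@le_geometric _ _ (4 * C)) => m; rewrite add0r.
  rewrite -(subrKA (u m.+1 s)) (le_trans (ler_normD _ _))//.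
  have H t : `|u m t - z t| <= 4 * C / 2 ^+ m.
    by apply: le_trans (uz t m) _; rewrite mulrA -natrM.
  have := lerD (uz s m.+1) (T_contract (@u_continuous m) cz H s).
  rewrite distrC => /le_trans; apply.
  by rewrite exprS invfM; lra.
exists z; first by rewrite Tz /T clamp_id ?P0 ?addr0//; lra.
move=> s /andP[s1 s2] i.
(* Inside the open interval the clamp is the identity, so the fixed point equation can be
   differentiated. *)
have : \near s, (fun t => x i 0 + P (G \o z) t i 0) s = z s i 0.
  have : s \in `](-1), 2[ by rewrite in_itv/= s1.
  move=> /near_in_itvoo; apply: filterS => t; rewrite in_itv/=.
  move=> /andP[/ltW t1 /ltW t2].
  by rewrite [in RHS]Tz /T clamp_id ?t1// !mxE.
move=> /near_eq_is_derive; apply.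
rewrite -[G (z s) i 0]add0r; apply: is_deriveD.
by apply: P_derive; [exact: cG|lra].
Qed.

End Picard.

End Curves.

(** * Comparison with approximate solutions, and Taylor estimates on a box *)

Section Frobenius.
Context {R : realType}.

(** A maximum argument in place of Gronwall's inequality: where [|w - z|] is largest on [[0, 1]],
    the mean value bound gives [|v c| <= d + |v c| / 4]. *)
Lemma almost_solution_close n (G : 'cV[R]_n -> 'cV[R]_n) (z w dw : R -> 'cV[R]_n) (d : R) :
  (forall p q, `|G p - G q| <= 4^-1 * `|p - q|) ->
  curve_derive z (fun s => G (z s)) -> z 0 = w 0 ->
  (forall s : R, 0 <= s <= 1 ->
     forall i, is_derive s 1 (fun t => w t i 0) (dw s i 0)) ->
  (forall s : R, 0 <= s <= 1 -> `|dw s - G (w s)| <= d) ->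
  `|w 1 - z 1| <= 2 * d.
Proof.
move=> GL zd zw wd wG.
have i01 (s : R) : 0 <= s <= 1 -> -1 < s < 2.
  by case/andP => ? ?; apply/andP; split; lra.
pose v t := w t - z t.
have vd (s : R) : 0 <= s <= 1 -> forall i,
    is_derive s 1 (fun t => v t i 0) ((dw s - G (z s)) i 0).
  move=> s01 i; rewrite (_ : (fun t => _) = fun t => w t i 0 - z t i 0).
    by rewrite !mxE; apply: is_deriveB; [exact: wd | exact/zd/i01].
  by apply/funext => t; rewrite !mxE.
have cv : {within `[0, 1], continuous (fun t : R => `|v t|)}.
  apply: continuous_in_subspaceT => s; rewrite inE/= in_itv/= => s01.
  apply: (@continuous_comp _ _ _ v (fun M : 'cV[R]_n => `|M|)); last exact: norm_continuous.
  apply: differentiable_continuous; apply: differentiable_mx => i j.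
  by rewrite (ord1 j); apply/derivable1_diffP; have [] := vd s s01 i.
have [c] := EVT_max ler01 cv; rewrite in_itv/= => /andP[c0 c1] vmax.
have dvc : `|v c - v 0| <= (d + 4^-1 * `|v c|) * (c - 0).
  have d0 : 0 <= d.
    by apply: le_trans (normr_ge0 _) (wG 0 _); rewrite lexx ler01.
  apply: (@curve_bound _ _ v (fun s => dw s - G (z s))) => //.
  - by rewrite addr_ge0// mulr_ge0// invr_ge0.
  - by move=> s /andP[s0 sc]; apply: vd; rewrite s0 (le_trans sc c1).
  - move=> s /andP[s0 sc].
    have s01 : 0 <= s <= 1 by rewrite s0 (le_trans sc c1).
    rewrite -(subrKA (G (w s))) (le_trans (ler_normD _ _))// lerD ?wG//.
    apply: le_trans (GL _ _) _; rewrite ler_wpM2l ?invr_ge0//.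
    by apply: vmax; rewrite in_itv.
have v0 : v 0 = 0 by rewrite /v zw subrr.
have v1 : `|v 1| <= `|v c| by apply: vmax; rewrite in_itv/= ler01 lexx.
move: dvc; rewrite v0 !subr0 => dvc.
apply: le_trans v1 _.
have := normr_ge0 (v c); have d0 : 0 <= d.
  by apply: le_trans (normr_ge0 _) (wG 0 _); rewrite lexx ler01.
by nra.
Qed.

Lemma near_bounded (T : finType) n (f : T -> 'cV[R]_n -> R) x :
  (forall t, differentiable (f t) x) ->
  exists2 C, 0 <= C & \forall y \near x, forall t, `|f t y| <= C.
Proof.
(* A sum of nonnegative terms dominates each of them and serves as the common bound. *)
move=> df; exists (\sum_t (`|f t x| + 1)).
  by apply: sumr_ge0 => t _; rewrite addr_ge0.
suff H t : \forall y \near x, `|f t y| <= \sum_t (`|f t x| + 1).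
  exact: (@filter_forall _ _ _ (nbhs x) (nbhs_filter x) H).
have cf : {for x, continuous (f t)} by exact: differentiable_continuous.
have : \forall y \near x, `|f t x - f t y| <= 1.
  by move/cvgrPdist_le : cf; exact.
apply: filterS => y fy; apply: (@le_trans _ _ (`|f t x| + 1)).
  have := ler_normB (f t x) (f t x - f t y); rewrite opprB addrC subrK.
  by move=> /le_trans; apply; rewrite lerD2l.
rewrite (bigD1 t)//= lerDl; apply: sumr_ge0 => u _.
by rewrite addr_ge0.
Qed.

Lemma segment_box n (x p q : 'cV[R]_n) (rho t : R) :
  `|p - x| <= rho -> `|q - x| <= rho -> 0 <= t <= 1 ->
  `|q + t *: (p - q) - x| <= rho.
Proof.
move=> px qx /andP[t0 t1].
have -> : q + t *: (p - q) - x = t *: (p - x) + (1 - t) *: (q - x).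
  by apply/matrixP => i j; rewrite !mxE; ring.
apply: le_trans (ler_normD _ _) _; rewrite !normrZ !ger0_norm ?subr_ge0//.
by nra.
Qed.

Lemma is_derive_segment n (p q : 'cV[R]_n) (t : R) i :
  is_derive t 1 (fun t => (q + t *: (p - q)) i 0) ((p - q) i 0).
Proof.
rewrite (_ : (fun t => _) = fun t => q i 0 + t * (p - q) i 0); last first.
  by apply/funext => u; rewrite !mxE.
rewrite -[X in is_derive _ _ _ X]add0r; apply: is_deriveD.
have := @is_deriveM _ _ id (cst ((p - q) i 0)) t 1 _ _ (is_derive_id t 1)
  (is_derive_cst ((p - q) i 0) t 1).
by rewrite /GRing.scale /= mulr0 mulr1 add0r.
Qed.

Lemma pd_lipschitz n (f : 'cV[R]_n -> R) (x : 'cV[R]_n) (rho C : R) : 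
  (forall y, `|y - x| <= rho -> differentiable f y) ->
  (forall y, `|y - x| <= rho -> forall l, `|pd l f y| <= C) ->
  forall p q, `|p - x| <= rho -> `|q - x| <= rho ->
  `|f p - f q| <= n%:R * C * `|p - q|.
Proof.
move=> df fC p q px qx.
have := @mvt_bound _ (fun t => f (q + t *: (p - q)))
  (fun t => \sum_l pd l f (q + t *: (p - q)) * (p - q) l 0) 0 1
  (n%:R * C * `|p - q|) ler01.
rewrite scale1r scale0r addr0 subr0 mulr1 [q + (p - q)]addrC subrK; apply.
- move=> t t01; apply: (is_derive_curve (dz := fun=> p - q)).
    by apply: df; exact: segment_box.
  by move=> i; exact: is_derive_segment.
- move=> t t01; apply: le_trans (ler_norm_sum _ _ _) _.
  rewrite -mulrA mulr_natl -[n in _ *+ n]card_ord -sumr_const ler_sum// => l _.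
  by rewrite normrM ler_pM// ?le_mx_norm// fC//; exact: segment_box.
Qed.

(** Along the segment from [q] to [p], subtracting [t a] leaves as derivative the change of the
    gradient paired with [p - q]. Each partial derivative is Lipschitz by the bound on second
    derivatives; the two summations over coordinates produce [n^2]. *)
Lemma pd_taylor n (f : 'cV[R]_n -> R) (x : 'cV[R]_n) (rho C : R) : 0 <= C ->
  (forall y, `|y - x| <= rho -> differentiable f y) ->
  (forall y l, `|y - x| <= rho -> differentiable (pd l f) y) ->
  (forall y, `|y - x| <= rho -> forall l m, `|pd m (pd l f) y| <= C) ->
  forall p q, `|p - x| <= rho -> `|q - x| <= rho ->
  `|f p - f q - \sum_l pd l f q * (p - q) l 0| <= n%:R ^+ 2 * C * `|p - q| ^+ 2.
Proof.
move=> C0 df ddf fC p q px qx.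
pose a := \sum_l pd l f q * (p - q) l 0.
have := @mvt_bound _ (fun t => f (q + t *: (p - q)) - t * a)
  (fun t => \sum_l pd l f (q + t *: (p - q)) * (p - q) l 0 - a) 0 1
  (n%:R ^+ 2 * C * `|p - q| ^+ 2) ler01.
rewrite scale1r scale0r addr0 subr0 mulr1 mul1r mul0r subr0 [q + (p - q)]addrC subrK.
rewrite addrAC; apply.
- move=> t t01; apply: is_deriveB.
    apply: (is_derive_curve (dz := fun=> p - q)).
      by apply: df; exact: segment_box.
    by move=> i; exact: is_derive_segment.
  have := @is_deriveM _ _ id (cst a) t 1 _ _ (is_derive_id t 1)
    (is_derive_cst a t 1).
  by rewrite /GRing.scale /= mulr0 mulr1 add0r.
- move=> t t01; rewrite /a -sumrB; apply: le_trans (ler_norm_sum _ _ _) _.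
  have -> : n%:R ^+ 2 * C * `|p - q| ^+ 2 =
      n%:R * ((n%:R * C * `|p - q|) * `|p - q|) by ring.
  rewrite mulr_natl -[n in _ *+ n]card_ord -sumr_const ler_sum// => l _.
  rewrite -mulrBl normrM ler_pM// ?le_mx_norm//.
  apply: le_trans (pd_lipschitz (C := C) (x := x) (rho := rho) _ _ _ _) _ => //.
  - by move=> y; exact: ddf.
  - by move=> y yx m; exact: fC.
  - exact: segment_box.
  - rewrite ler_wpM2l ?mulr_ge0// addrC addKr normrZ.
    case/andP: t01 => t0 t1; rewrite ger0_norm//.
    by rewrite ler_piMl.
Qed.

End Frobenius.

(** * Integral manifolds of commuting frames *)

Section FrobeniusCore.
Context {R : realType}.

(** The derivative of [B] at [y] in the direction [w]. Written with partial derivatives, it is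
    linear in [w] without any differentiability assumption. *)
Definition mxderiv n p q (B : 'cV[R]_n -> 'M[R]_(p, q)) (y w : 'cV[R]_n) :
    'M[R]_(p, q) :=
  \matrix_(i, j) \sum_l pd l (fun z => B z i j) y * w l 0.

Lemma mxderivZ n p q (B : 'cV[R]_n -> 'M[R]_(p, q)) y a w :
  mxderiv B y (a *: w) = a *: mxderiv B y w.
Proof.
apply/matrixP => i j; rewrite !mxE mulr_sumr; apply: eq_bigr => l _.
by rewrite !mxE; ring.
Qed.

Lemma ball_box n (x : 'cV[R]_n) (P : set 'cV[R]_n) : nbhs x P ->
  exists2 rho, 0 < rho & forall y, `|y - x| <= rho -> P y.
Proof.
move=> /nbhs_ballP[e /= e0 He]; exists (e / 2); first by rewrite divr_gt0.
move=> y yx; apply: He; rewrite -ball_normE /= distrC.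
by apply: le_lt_trans yx _; rewrite ltr_pdivrMr// ltr_pMr// ltr1n.
Qed.

Lemma smooth_box_bounds n p q (U : set 'cV[R]_n) (B : 'cV[R]_n -> 'M[R]_(p, q)) x :
  open U -> U x -> smooth_mx U B ->
  exists rho C, [/\ 0 < rho, 0 <= C & forall y, `|y - x| <= rho ->
    [/\ U y, `|B y| <= C, forall i j l, `|pd l (fun z => B z i j) y| <= C &
        forall i j l m, `|pd m (pd l (fun z => B z i j)) y| <= C]].
Proof.
move=> oU Ux sB.
have [C1 C10 H1] := @near_bounded _ ('I_p * 'I_q)%type n
  (fun t y => B y t.1 t.2) x (fun t => smooth_on_differentiable (sB _ _) Ux).
have [C2 C20 H2] := @near_bounded _ ('I_p * 'I_q * 'I_n)%type n
  (fun t y => pd t.2 (fun z => B z t.1.1 t.1.2) y) x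
  (fun t => smooth_on_differentiable (smooth_on_pd _ (sB _ _)) Ux).
have [C3 C30 H3] := @near_bounded _ ('I_p * 'I_q * 'I_n * 'I_n)%type n
  (fun t y => pd t.2 (pd t.1.2 (fun z => B z t.1.1.1 t.1.1.2)) y) x
  (fun t => smooth_on_differentiable (smooth_on_pd _ (smooth_on_pd _ (sB _ _))) Ux).
have nU : nbhs x U by exact: open_nbhs_nbhs.
have [rho rho0 Hrho] := ball_box (filterI (filterI nU H1) (filterI H2 H3)).
exists rho, (C1 + C2 + C3); split => [//||y /Hrho[[Uy h1] [h2 h3]]].
  by rewrite !addr_ge0.
split=> [//||i j l|i j l m].
- apply/mx_norm_leP => [|i j]; first by rewrite !addr_ge0.
  by apply: le_trans (h1 (i, j)) _; lra.
- by apply: le_trans (h2 (i, j, l)) _; lra.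
- by apply: le_trans (h3 (i, j, l, m)) _; lra.
Qed.

(** A second-order error pins down the differential: [E |h|^2 <= e |h|] as soon as
    [|h| <= e / (|E| + 1)]. *)
Lemma quadratic_error_jac m n (f : 'cV[R]_m -> 'cV[R]_n) (A : 'M[R]_(n, m)) y
    (E : R) :
  (\forall h \near (0 : 'cV[R]_m),
     `|f (y + h) - (f y + A *m h)| <= E * `|h| ^+ 2) ->
  (forall i, differentiable (fun q => f q i 0) y) /\ jac f y = A.
Proof.
move=> fE.
have cA : continuous (mulmx A : 'cV[R]_m -> 'cV[R]_n).
  apply: (@lipschitz_continuous _ _ _ _ (m%:R * `|A|)) => p q.
  by rewrite -mulmxBr mulmx_norm.
have HL e : 0 < e -> \forall h \near (0 : 'cV[R]_m),
    `|f (h + y) - (f y + A *m h)| <= e * `|h|.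
  move=> e0; have e1 : 0 < e / (`|E| + 1) by rewrite divr_gt0// ltr_wpDl.
  have : \forall h \near (0 : 'cV[R]_m), `|h| <= e / (`|E| + 1).
    apply/nbhs_ballP; exists (e / (`|E| + 1)) => //= h.
    by rewrite -ball_normE /= sub0r normrN => /ltW.
  move: fE; apply: filterS2 => h; rewrite (addrC y) => Eh.
  rewrite ler_pdivlMr ?ltr_wpDl// => he; apply: le_trans Eh _.
  rewrite expr2 mulrA ler_wpM2r//; have := ler_norm E.
  by have := normr_ge0 h; nra.
have dfy : differentiable f y.
  by apply/differentiable_epsP; exists (mulmx A : {linear 'cV[R]_m -> 'cV[R]_n}).
have dfi i j : differentiable (fun q => f q i j) y.
  apply: (@differentiable_comp _ _ _ _ f (fun M : 'cV[R]_n => M i j)) => //.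
  exact: differentiable_coord.
split=> [i|]; first exact: dfi.
apply/matrixP => i k; rewrite mxE /pd deriveE// -diff_mxE//.
rewrite (diff_epsE (L := mulmx A) cA HL).
by rewrite -[LHS]/((A *m delta_mx k 0) i 0) -colE mxE.
Qed.

(** [D] is positive and dominates both [k C] and [k n C]. For [|y|] up to this number, the cut-off
    field [B (c p) y] is [1/4]-Lipschitz in [p], as [picard] requires, and its solutions move by at
    most [rho / 4] in unit time. *)
Definition leaf_eps (n k : nat) (rho C : R) : R :=
  let D := k%:R * (n%:R + 1) * C + 1 in Num.min (4^-1 / D) (rho / 4 / D).

Section Leaf.
Context {n k : nat} (U : set 'cV[R]_n) (B : 'cV[R]_n -> 'M[R]_(n, k)).
Hypothesis oU : open U.
Hypothesis sB : smooth_mx U B.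
Hypothesis flatB : forall p, U p -> forall a b : 'cV[R]_k,
  mxderiv B p (B p *m a) *m b = mxderiv B p (B p *m b) *m a.

Variables (x : 'cV[R]_n) (rho C : R).
Hypotheses (rho0 : 0 < rho) (C0 : 0 <= C).
Hypothesis box : forall y, `|y - x| <= rho ->
  [/\ U y, `|B y| <= C, forall i j l, `|pd l (fun z => B z i j) y| <= C &
      forall i j l m, `|pd m (pd l (fun z => B z i j)) y| <= C].

Let dB y i j : `|y - x| <= rho -> differentiable (fun z => B z i j) y.
Proof. by case/box => Uy *; exact: smooth_on_differentiable (sB i j) Uy. Qed.

Let B_lipschitz p q : `|p - x| <= rho -> `|q - x| <= rho ->
  `|B p - B q| <= n%:R * C * `|p - q|.
Proof.
move=> px qx; apply/mx_norm_leP => [|i j]; first by rewrite !mulr_ge0.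
rewrite !mxE; apply: (@pd_lipschitz _ _ (fun z => B z i j) x rho) => // y yx.
  exact: dB.
by case: (box yx).
Qed.

Let B_taylor p q : `|p - x| <= rho -> `|q - x| <= rho ->
  `|B p - B q - mxderiv B q (p - q)| <= n%:R ^+ 2 * C * `|p - q| ^+ 2.
Proof.
move=> px qx; apply/mx_norm_leP => [|i j].
  by rewrite !mulr_ge0// exprn_ge0.
rewrite !mxE; have := @pd_taylor _ _ (fun z => B z i j) x rho C C0.
move=> /(_ _ _ _ p q px qx); rewrite (eq_bigr (fun l =>
  pd l (fun z => B z i j) q * (p - q) l 0)); last by move=> l _; rewrite !mxE.
apply=> [y yx|y l yx|y yx]; first exact: dB.
  case: (box yx) => Uy *.
  exact: smooth_on_differentiable (smooth_on_pd l (sB i j)) Uy.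
by case: (box yx).
Qed.

Let mxderiv_norm y w : `|y - x| <= rho -> `|mxderiv B y w| <= n%:R * C * `|w|.
Proof.
move=> yx; apply/mx_norm_leP => [|i j]; first by rewrite !mulr_ge0.
rewrite mxE; apply: le_trans (ler_norm_sum _ _ _) _.
rewrite -mulrA mulr_natl -[n in _ *+ n]card_ord -sumr_const ler_sum// => l _.
by rewrite normrM ler_pM// ?le_mx_norm//; case: (box yx).
Qed.

(* [B \o c] is bounded and Lipschitz on the whole space, and for small [y] the
   solutions starting at [x] stay in the box, where [c] is the identity. *)
Let c (p : 'cV[R]_n) : 'cV[R]_n :=
  \col_i (x i 0 + clamp (- rho) rho (p i 0 - x i 0)).

Let mrho : - rho <= rho. Proof. by have := rho0; lra. Qed.

Let c_box p : `|c p - x| <= rho.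
Proof.
apply/mx_norm_leP => [|i j]; first exact: ltW.
by rewrite (ord1 j) !mxE addrC addKr ler_norml clamp_bound.
Qed.

Let c_contract p q : `|c p - c q| <= `|p - q|.
Proof.
apply/mx_norm_leP => // i j; rewrite (ord1 j) !mxE opprD addrACA subrr add0r.
apply: le_trans (clamp_contract _ _ mrho) _.
rewrite opprB addrA subrK; apply: le_trans (le_mx_norm (p - q) i 0).
by rewrite !mxE.
Qed.

Let c_id p : `|p - x| <= rho -> c p = p.
Proof.
move=> px; apply/matrixP => i j; rewrite (ord1 j) mxE.
have : `|p i 0 - x i 0| <= rho.
  by apply: le_trans px; have := le_mx_norm (p - x) i 0; rewrite !mxE.
by rewrite ler_norml => /clamp_id ->; rewrite addrC subrK.
Qed.

Let N : R := n%:R.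
Let K : R := k%:R.
Let D := K * (N + 1) * C + 1.
Let eps := leaf_eps n k rho C.

Let N0 : 0 <= N. Proof. exact: ler0n. Qed.
Let K0 : 0 <= K. Proof. exact: ler0n. Qed.
Let KC0 : 0 <= K * C. Proof. exact: mulr_ge0. Qed.
Let D0 : 0 < D.
Proof. by rewrite /D ltr_wpDl// !mulr_ge0// addr_ge0. Qed.

Lemma leaf_eps_gt0 : 0 < eps.
Proof. by rewrite /eps /leaf_eps lt_min !divr_gt0. Qed.

Let eps_box y : y <= eps -> K * C * y <= rho / 4.
Proof.
rewrite /eps /leaf_eps le_min => /andP[_]; rewrite ler_pdivlMr// => H.
case: (leP 0 y) => y0; last first.
  by apply: (@le_trans _ _ 0); [rewrite mulr_ge0_le0// ltW | have := rho0; lra].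
apply: le_trans H; rewrite /D; have := mulr_ge0 (mulr_ge0 KC0 N0) y0; nra.
Qed.

Let eps_contract y : y <= eps -> N * (K * C) * y <= 4^-1.
Proof.
rewrite /eps /leaf_eps le_min => /andP[+ _]; rewrite ler_pdivlMr// => H.
case: (leP 0 y) => y0; last first.
  apply: (@le_trans _ _ 0); last by lra.
  by rewrite mulr_ge0_le0// ?mulr_ge0// ltW.
apply: le_trans H; rewrite /D; have := mulr_ge0 KC0 y0; nra.
Qed.

Let G (y : 'cV[R]_k) (p : 'cV[R]_n) := B (c p) *m y.

Let G_contract y p q : `|y| <= eps -> `|G y p - G y q| <= 4^-1 * `|p - q|.
Proof.
move=> ye; rewrite /G -mulmxBl; apply: le_trans (mulmx_norm _ _) _.
have H := B_lipschitz (c_box p) (c_box q).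
have H' := c_contract p q.
have E := eps_contract ye.
apply: (@le_trans _ _ (K * (N * C * `|p - q|) * `|y|)).
  rewrite ler_wpM2r// ler_wpM2l//; apply: le_trans H _.
  by rewrite ler_wpM2l// mulr_ge0.
have := normr_ge0 (p - q); nra.
Qed.

Let G_bound y p : `|G y p| <= K * C * `|y|.
Proof.
apply: le_trans (mulmx_norm _ _) _; rewrite ler_wpM2r// ler_wpM2l//.
by case: (box (c_box p)).
Qed.

Lemma leaf_exists : exists z : 'cV[R]_k -> R -> 'cV[R]_n,
  forall y, `|y| <= eps ->
    z y 0 = x /\ curve_derive (z y) (fun s => G y (z y s)).
Proof.
have H y : exists z : R -> 'cV[R]_n, `|y| <= eps ->
    z 0 = x /\ curve_derive z (fun s => G y (z s)).
  case: (leP `|y| eps) => ye; last by exists (cst x).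
  have [z z0 zd] := picard x (fun p q => G_contract p q ye) (G_bound y).
  by exists z.
by have [z Hz] := choice H; exists z.
Qed.

Variable z : 'cV[R]_k -> R -> 'cV[R]_n.
Hypothesis Hz : forall y, `|y| <= eps ->
  z y 0 = x /\ curve_derive (z y) (fun s => G y (z y s)).

Let z_box y (s : R) : `|y| <= eps -> 0 <= s <= 1 -> `|z y s - x| <= rho / 4.
Proof.
move=> ye /andP[s0 s1]; have [z0 zd] := Hz ye.
rewrite -z0; apply: le_trans (eps_box ye).
have := @curve_bound _ _ (z y) (fun s => G y (z y s)) 0 s (K * C * `|y|) s0.
have KCy : 0 <= K * C * `|y| by rewrite mulr_ge0.
move=> /(_ KCy) H; apply: le_trans (H _ _) _.
- by move=> t /andP[t0 ts] i; apply: zd; apply/andP; split; lra.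
- by move=> t _; exact: G_bound.
- by rewrite subr0 ler_piMr.
Qed.

Let z_rho y s : `|y| <= eps -> 0 <= s <= 1 -> `|z y s - x| <= rho.
Proof. by move=> ye s01; apply: le_trans (z_box ye s01) _; have := rho0; lra. Qed.

Definition leaf_map (y : 'cV[R]_k) : 'cV[R]_n := z y 1.

Let i11 : 0 <= (1 : R) <= 1. Proof. by rewrite ler01 lexx. Qed.

Let leaf_error y h : `|y| <= eps -> `|y + h| <= eps ->
  `|leaf_map (y + h) - (leaf_map y + B (leaf_map y) *m h)| <=
  2 * ((K * (N ^+ 2 * C * (K * C) ^+ 2) * eps + K * (N * C * (K * C))) * `|h| ^+ 2).
Proof.
move=> ye yhe; have [z0 zd] := Hz ye; have [z0' zd'] := Hz yhe.
(* Then the displacement [s B h] has size at most [rho / 2], and [w] stays within [3 rho / 4] of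
   [x], where the Taylor bound for [B] holds. *)
have he : `|h| <= 2 * eps.
  have := ler_normB (y + h) y; rewrite addrC addKr; lra.
have KCh : K * C * `|h| <= rho / 2.
  have : `|h| / 2 <= eps by lra.
  by move=> /eps_box; lra.
(* By [flatB], the defect of [w] as a solution for [y + h] is quadratic in [h]. *)
pose w (s : R) := z y s + s *: (B (z y s) *m h).
pose dw (s : R) := B (z y s) *m y + B (z y s) *m h
   + s *: (mxderiv B (z y s) (B (z y s) *m y) *m h).
have -> : leaf_map y + B (leaf_map y) *m h = w 1.
  by rewrite /w scale1r.
rewrite distrC; apply: (@almost_solution_close _ _ (G (y + h)) _ w dw) => //.
- by move=> p q; exact: G_contract.
- by rewrite z0' /w scale0r addr0 z0.
- move=> s s01 i.
  have zs i' : is_derive s 1 (fun t => z y t i' 0) ((B (z y s) *m y) i' 0).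
    have := zd s _ i'; rewrite /G c_id; last exact: z_rho.
    by apply; case/andP: s01 => ? ?; apply/andP; split; lra.
  have Bs i' j' : is_derive s 1 (fun t => B (z y t) i' j')
      (mxderiv B (z y s) (B (z y s) *m y) i' j').
    rewrite mxE; apply: (@is_derive_curve _ _ (fun q => B q i' j') (z y)
      (fun=> B (z y s) *m y)) => //.
    by apply: dB; exact: z_rho.
  have Bh : is_derive s 1 (fun t => (B (z y t) *m h) i 0)
      ((mxderiv B (z y s) (B (z y s) *m y) *m h) i 0).
    rewrite (_ : (fun t => _) = \sum_j (fun t => B (z y t) i j * h j 0)); last first.
      by apply/funext => t; rewrite fct_sumE mxE.
    rewrite mxE; apply: is_derive_sum => j.
    have := @is_deriveM _ _ (fun t => B (z y t) i j) (cst (h j 0)) s 1 _ _ (Bs i j)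
      (is_derive_cst (h j 0) s 1).
    by rewrite /GRing.scale /= mulr0 add0r [h j 0 * _]mulrC.
  rewrite (_ : (fun t => _) = fun t => z y t i 0 + t * (B (z y t) *m h) i 0); last first.
    by apply/funext => t; rewrite [LHS]mxE [X in _ + X]mxE.
  have -> : dw s i 0 = (B (z y s) *m y) i 0 + ((B (z y s) *m h) i 0
      + s * (mxderiv B (z y s) (B (z y s) *m y) *m h) i 0).
    by rewrite [LHS]mxE [X in X + _]mxE [X in _ + X]mxE addrA.
  apply: is_deriveD.
  have := @is_deriveM _ _ id (fun t => (B (z y t) *m h) i 0) s 1 _ _ (is_derive_id s 1) Bh.
  by rewrite /GRing.scale /= mulr1 addrC.
- move=> s s01.
  set p := z y s; have px : `|p - x| <= rho by exact: z_rho.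
  have px4 : `|p - x| <= rho / 4 by exact: z_box.
  have [Up Bp _ _] := box px.
  have Bph : `|B p *m h| <= K * C * `|h|.
    by apply: le_trans (mulmx_norm _ _) _; rewrite ler_wpM2r// ler_wpM2l.
  have wp : w s - p = s *: (B p *m h) by rewrite /w addrC addKr.
  case/andP: s01 => s0 s1.
  have wpn : `|w s - p| <= K * C * `|h|.
    rewrite wp normrZ (ger0_norm s0); apply: le_trans Bph.
    by rewrite ler_piMl.
  have wx : `|w s - x| <= rho.
    rewrite -(subrKA p) (le_trans (ler_normD _ _))//.
    by have := rho0; lra.
  rewrite /G (c_id wx) distrC.
  (* To first order, [B (w s) y] changes by the derivative of [B] along [s B h], applied to [y];
     commutation cancels this against the last term of [dw]. There remain the Taylor remainder of
     [B] and a term quadratic in [h]. *)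
  have -> : B (w s) *m (y + h) - dw s =
     (B (w s) - B p - mxderiv B p (w s - p)) *m (y + h)
     + s *: (mxderiv B p (B p *m h) *m h).
    rewrite /dw -/p wp mxderivZ !mulmxBl -scalemxAl [mxderiv _ _ _ *m (y + h)]mulmxDr.
    rewrite flatB// [B p *m (y + h)]mulmxDr scalerDr.
    by apply/matrixP => i j; rewrite !mxE; ring.
  rewrite mulrDl; apply: le_trans (ler_normD _ _) _; apply: lerD.
    apply: le_trans (mulmx_norm _ _) _.
    have T := B_taylor wx px.
    have T2 : `|w s - p| ^+ 2 <= (K * C) ^+ 2 * `|h| ^+ 2.
      have h0 : 0 <= K * C * `|h| by rewrite mulr_ge0.
      by rewrite -exprMn lerXn2r// nnegrE.
    apply: (@le_trans _ _ (K * (N ^+ 2 * C * ((K * C) ^+ 2 * `|h| ^+ 2)) * eps)).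
      apply: ler_pM => //.
      rewrite ler_wpM2l//; apply: le_trans T _.
      by rewrite ler_wpM2l// mulr_ge0// exprn_ge0.
    by rewrite le_eqVlt; apply/orP; left; apply/eqP; ring.
  rewrite normrZ (ger0_norm s0).
  apply: (@le_trans _ _ `|mxderiv B p (B p *m h) *m h|).
    by rewrite ler_piMl.
  apply: le_trans (mulmx_norm _ _) _.
  apply: (@le_trans _ _ (K * (N * C * (K * C * `|h|)) * `|h|)).
    rewrite ler_wpM2r// ler_wpM2l//; apply: le_trans (mxderiv_norm _ px) _.
    by rewrite ler_wpM2l// mulr_ge0.
  by rewrite le_eqVlt; apply/orP; left; apply/eqP; ring.
Qed.

Lemma leaf_map0 : leaf_map 0 = x.
Proof.
have e0 : `|0 : 'cV[R]_k| <= eps by rewrite normr0 ltW// leaf_eps_gt0.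
have [z0 zd] := Hz e0.
apply/eqP; rewrite -subr_eq0 -normr_le0 -z0.
have := @curve_bound _ _ (z 0) (fun s => G 0 (z 0 s)) 0 1 0 ler01 (lexx _).
rewrite mul0r; apply=> t /andP[t0 t1]; last by rewrite /G mulmx0 normr0.
by move=> i; apply: zd; apply/andP; split; lra.
Qed.

Lemma leaf_map_box y : `|y| <= eps -> `|leaf_map y - x| <= rho.
Proof. by move=> ye; exact: z_rho. Qed.

Let V := ball (0 : 'cV[R]_k) eps.

Let V_le y : V y -> `|y| <= eps.
Proof. by rewrite /V -ball_normE /= sub0r normrN => /ltW. Qed.

Let oV : open V. Proof. exact: ball_open. Qed.

Let leaf_jac_diff y : V y ->
  (forall i, differentiable (fun q => leaf_map q i 0) y) /\
  jac leaf_map y = B (leaf_map y).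
Proof.
move=> Vy.
apply: (quadratic_error_jac (E := 2 *
  (K * (N ^+ 2 * C * (K * C) ^+ 2) * eps + K * (N * C * (K * C))))).
have : \forall h \near (0 : 'cV[R]_k), V (y + h).
  have : \forall q \near y, V q by apply: open_nbhs_nbhs.
  rewrite (near_shift 0 y); apply: filterS => h /=.
  by rewrite subr0 addrC.
apply: filterS => h Vyh; rewrite -mulrA.
by apply: leaf_error; exact: V_le.
Qed.

Lemma leaf_jac y : V y -> jac leaf_map y = B (leaf_map y).
Proof. by case/leaf_jac_diff. Qed.

Lemma leaf_smooth : smooth_mx V leaf_map.
Proof.
have VU y : V y -> U (leaf_map y).
  by move=> /V_le /leaf_map_box /box[].
move=> i j m; rewrite (ord1 j) {j}.
elim: m i => [//|m IHm] i; split=> [y /leaf_jac_diff[d _]|l]; first exact: d.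
apply: diff_times_ext oV _ (diff_times_comp oV VU (sB i l m) IHm) => y Vy.
by rewrite -leaf_jac// mxE.
Qed.

End Leaf.

(* The third hypothesis says that the columns of [B] commute as vector fields. *)
Theorem commuting_frame_leaf n k (U : set 'cV[R]_n)
    (B : 'cV[R]_n -> 'M[R]_(n, k)) (x : 'cV[R]_n) :
  open U -> smooth_mx U B ->
  (forall p, U p -> forall a b : 'cV[R]_k,
     mxderiv B p (B p *m a) *m b = mxderiv B p (B p *m b) *m a) ->
  U x ->
  exists e (f : 'cV[R]_k -> 'cV[R]_n),
    [/\ 0 < e, f 0 = x, smooth_mx (ball 0 e) f &
        forall y, ball 0 e y -> U (f y) /\ jac f y = B (f y)].
Proof.
move=> oU sB flatB Ux.
have [rho [C [rho0 C0 box]]] := smooth_box_bounds oU Ux sB.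
have [z Hz] := leaf_exists sB rho0 C0 box.
eexists; exists (leaf_map z); split.
- exact: (leaf_eps_gt0 (n := n) (k := k) rho0 C0).
- exact: (leaf_map0 rho0 C0 Hz).
- exact: (leaf_smooth sB flatB rho0 C0 box Hz).
- move=> y Vy; split; last exact: (leaf_jac sB flatB rho0 C0 box Hz Vy).
  have ye : `|y| <= leaf_eps n k rho C.
    by move: Vy; rewrite -ball_normE /= sub0r normrN => /ltW.
  by have [] := box _ (leaf_map_box rho0 C0 box Hz ye).
Qed.

End FrobeniusCore.

(** * Involutive projector fields *)

Section InvolutiveProjector.
Context {R : realType}.

Lemma near_mxderiv n p q (F G : 'cV[R]_n -> 'M[R]_(p, q)) y w :
  (\near y, F y = G y) -> mxderiv F y w = mxderiv G y w.
Proof.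
move=> FG; apply/matrixP => i j; rewrite !mxE; apply: eq_bigr => l _.
by congr (_ * _); apply: near_pd; apply: filterS FG => z ->.
Qed.

Lemma mxderiv_cst n p q (C : 'M[R]_(p, q)) (y w : 'cV[R]_n) :
  mxderiv (fun=> C) y w = 0.
Proof.
by apply/matrixP => i j; rewrite !mxE big1// => l _; rewrite pd_cst mul0r.
Qed.

Lemma mxderivM n p q r (F : 'cV[R]_n -> 'M[R]_(p, q)) (G : 'cV[R]_n -> 'M[R]_(q, r))
    y w :
  (forall i j, differentiable (fun z => F z i j) y) ->
  (forall i j, differentiable (fun z => G z i j) y) ->
  mxderiv (fun z => F z *m G z) y w = mxderiv F y w *m G y + F y *m mxderiv G y w.
Proof.
move=> dF dG; apply/matrixP => i j; rewrite !mxE.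
have -> : (fun z => (F z *m G z) i j) = fun z => \sum_k F z i k * G z k j.
  by apply/funext => z; rewrite mxE.
under eq_bigr => l _.
  rewrite pd_sum; last by move=> k; apply: differentiableM.
  rewrite mulr_suml; over.
rewrite exchange_big -big_split; apply: eq_bigr => k _ /=.
rewrite !mxE mulr_suml mulr_sumr -big_split; apply: eq_bigr => l _ /=.
by rewrite pdM//; ring.
Qed.

Lemma open_smooth_neq0 n (U : set 'cV[R]_n) f : open U -> smooth_on U f ->
  open [set p | U p /\ f p != 0].
Proof.
move=> oU sf; rewrite openE => p /= [Up fp]; rewrite /interior.
have cf : {for p, continuous f}.
  by apply: differentiable_continuous; exact: smooth_on_differentiable sf Up.
have nU : nbhs p U by exact: open_nbhs_nbhs.
have nf : \forall q \near p, f q != 0.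
  have : \forall q \near p, `|f p - f q| < `|f p|.
    by move/cvgrPdist_lt : cf; apply; rewrite normr_gt0.
  by apply: filterS => q; apply: contraTneq => ->; rewrite subr0 ltxx.
by apply: filterS2 nU nf => q.
Qed.

(** In the rank factorization [P = C D], the equation [C D C D = C D] can be cancelled by a left
    inverse of [C] and a right inverse of [D], which leaves [D C = 1]. *)
Lemma idempotent_col_row_base p (P : 'M[R]_p) : P *m P = P ->
  row_base P *m col_base P = 1%:M.
Proof.
move=> PP; have /row_fullP[L] := col_base_full P.
have /row_freeP[M] := row_base_free P.
have : (col_base P *m row_base P) *m (col_base P *m row_base P)
     = col_base P *m row_base P by rewrite mulmx_base.
move: (col_base P) (row_base P) => C D CD DM LC.
have : L *m (C *m D *m (C *m D)) *m M = L *m (C *m D) *m M by rewrite CD.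
by rewrite !mulmxA LC !mul1mx DM -!mulmxA DM mulmx1.
Qed.

Section Leaf.
Context {n : nat} (U : set 'cV[R]_n) (P : 'cV[R]_n -> 'M[R]_n) (x : 'cV[R]_n).
Hypotheses (oU : open U) (Ux : U x) (sP : smooth_mx U P).
Hypothesis PP : forall p, U p -> P p *m P p = P p.
Hypothesis rankP : forall p, U p -> \rank (P p) = \rank (P x).
Hypothesis involP : forall p, U p -> forall u v : 'cV[R]_n,
  (1%:M - P p) *m (mxderiv P p (P p *m u) *m v - mxderiv P p (P p *m v) *m u) = 0.

Let k := \rank (P x).
Let pr : 'M[R]_(k, n) := row_base (P x).
Let E : 'M[R]_(n, k) := col_base (P x).
Let A p : 'M[R]_k := pr *m P p *m E.
Let U' := [set p | U p /\ \det (A p) != 0].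
(** The frame of the image of [P] normalized by [pr *m B = 1]. Its [pr]-components are constant, so
    [pr] kills the brackets of its columns; involutivity puts these brackets into the image of [P],
    where [pr] is injective. Hence the columns commute. *)
Let B p : 'M[R]_(n, k) := P p *m E *m invmx (A p).

Let sA : smooth_mx U A.
Proof.
by apply: smooth_mxM (smooth_mx_cst _ _) => //; apply: smooth_mxM => //;
  exact: smooth_mx_cst.
Qed.

Let oU' : open U'.
Proof. by apply: open_smooth_neq0 => //; exact: smooth_det. Qed.

Let U'U : U' `<=` U. Proof. by move=> p []. Qed.

Let U'x : U' x.
Proof.
split=> //; have prE : pr *m E = 1%:M by exact: idempotent_col_row_base (PP Ux).
have -> : A x = 1%:M; last by rewrite det1 oner_neq0.
have -> : A x = pr *m (E *m pr) *m E by rewrite [E *m pr]mulmx_base.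
by rewrite mulmxA prE mul1mx prE.
Qed.

Let uA p : U' p -> A p \in unitmx.
Proof. by move=> [_]; rewrite unitmxE unitfE. Qed.

Let sB : smooth_mx U' B.
Proof.
apply: smooth_mxM => //.
  apply: smooth_mxM => //; [exact: smooth_mx_sub sP | exact: smooth_mx_cst].
by apply: smooth_invmx => //; exact: smooth_mx_sub sA.
Qed.

Let prB p : U' p -> pr *m B p = 1%:M.
Proof.
move=> U'p; rewrite /B mulmxA [pr *m (P p *m E)]mulmxA.
exact: mulmxV (uA U'p).
Qed.

Let PB p : U' p -> P p *m B p = B p.
Proof. by move=> U'p; rewrite /B !mulmxA PP//; exact: U'U. Qed.

Let rankB p : U' p -> \rank (B p) = k.
Proof.
move=> U'p; apply/eqP; rewrite eqn_leq rank_leq_col /=.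
by rewrite -[X in (X <= _)%N](mxrank1 R k) -(prB U'p) mxrankM_maxr.
Qed.

Let imB p (v : 'cV[R]_n) : U' p -> P p *m v = v -> v = B p *m (pr *m v).
Proof.
move=> U'p Pv; have Up := U'U U'p.
have BP : ((B p)^T <= (P p)^T)%MS.
  by rewrite -(PB U'p) trmx_mul submxMl.
(* The columns of [B] lie in the image of [P]; constancy of the rank turns this inclusion into an
   equality. *)
have PB' : ((P p)^T <= (B p)^T)%MS.
  by rewrite -(mxrank_leqif_sup BP) !mxrank_tr rankB// rankP.
have /submxP[w vw] : (v^T <= (B p)^T)%MS.
  by apply: submx_trans PB'; rewrite -Pv trmx_mul submxMl.
have -> : v = B p *m w^T by rewrite -[v]trmxK vw trmx_mul trmxK.
by rewrite [pr *m _]mulmxA prB// mul1mx.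
Qed.

Let dP p : U p -> forall i j, differentiable (fun z => P z i j) p.
Proof. by move=> Up i j; exact: smooth_on_differentiable (sP i j) Up. Qed.

Let dB p : U' p -> forall i j, differentiable (fun z => B z i j) p.
Proof. by move=> Up i j; exact: smooth_on_differentiable (sB i j) Up. Qed.

Let flatB p : U' p -> forall a b : 'cV[R]_k,
  mxderiv B p (B p *m a) *m b = mxderiv B p (B p *m b) *m a.
Proof.
move=> U'p a b; have Up := U'U U'p.
have nU' : \forall q \near p, U' q by apply: open_nbhs_nbhs.
have prdB w : pr *m mxderiv B p w = 0.
  have : mxderiv (fun q => pr *m B q) p w = 0.
    rewrite -(mxderiv_cst (1%:M : 'M[R]_k) p w); apply: near_mxderiv.
    by apply: filterS nU' => q /prB.
  rewrite mxderivM ?mxderiv_cst ?mul0mx ?add0r// => i j;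
    by [exact: dB | exact: differentiable_cst].
(* Differentiating [P B = B] moves the derivative from [B] to [P], the form in which involutivity is
   given. *)
have dBE w c : (1%:M - P p) *m (mxderiv B p w *m c) = mxderiv P p w *m (B p *m c).
  have : mxderiv (fun q => P q *m B q) p w = mxderiv B p w.
    by apply: near_mxderiv; apply: filterS nU' => q /PB.
  rewrite mxderivM//; [|exact: dP|exact: dB] => dE.
  by rewrite mulmxBl mul1mx -{1}dE mulmxDl -!mulmxA addrK.
set X := mxderiv B p (B p *m a) *m b; set Y := mxderiv B p (B p *m b) *m a.
have XY : (1%:M - P p) *m (X - Y) = 0.
  have := involP Up (B p *m a) (B p *m b).
  rewrite ![P p *m (B p *m _)]mulmxA PB// -!dBE -mulmxBr mulmxA.
  suff -> : (1%:M - P p) *m (1%:M - P p) = 1%:M - P p by [].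
  by rewrite mulmxBr mulmx1 mulmxBl mul1mx PP// subrr subr0.
have PXY : P p *m (X - Y) = X - Y.
  by apply/esym/eqP; rewrite -subr_eq0 -{1}(mul1mx (X - Y)) -mulmxBl XY.
apply/eqP; rewrite -subr_eq0; apply/eqP.
rewrite (imB U'p PXY) mulmxBr !mulmxA prdB prdB !mul0mx subrr.
by rewrite mulmx0.
Qed.

Theorem involutive_projector_leaf :
  exists e (f : 'cV[R]_(\rank (P x)) -> 'cV[R]_n),
    [/\ 0 < e, f 0 = x, smooth_mx (ball 0 e) f,
        forall y z, ball 0 e y -> ball 0 e z -> f y = f z -> y = z &
        forall y, ball 0 e y -> [/\ U (f y), \rank (jac f y) = \rank (P x) &
          forall v : 'cV[R]_n, P (f y) *m v = v <-> exists w, jac f y *m w = v]].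
Proof.
have [e [f [e0 f0 sf jf]]] := commuting_frame_leaf oU' sB flatB U'x.
exists e, f; split=> //; last first.
  move=> y /jf[U'y ->]; split; [exact: U'U | exact: rankB |].
  move=> v; split=> [/(imB U'y)|[w <-]]; last by rewrite mulmxA PB.
  by exists (pr *m v).
have ballE (q : 'cV[R]_k) : ball 0 e q <-> `|q| < e by rewrite -ball_normE /= sub0r normrN.
move=> y z Vy Vz fyz.
(* Since [pr *m jac f = pr *m B (f) = 1], the map [g] has zero derivative. It is constant on the
   closed ball of radius [rho], which is convex, contains [y] and [z], and lies in the domain of
   [f]. *)
pose g q : 'cV[R]_k := pr *m f q - q.
pose rho := Num.max `|y| `|z|.
have rhoV (q : 'cV[R]_k) : `|q - 0| <= rho -> ball 0 e q.
  rewrite subr0 => /le_lt_trans qr; apply/ballE; apply: qr.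
  by rewrite /rho gt_max; apply/andP; split; exact/ballE.
have dfi q i : ball 0 e q -> differentiable (fun q => f q i 0) q.
  by move=> Vq; exact: smooth_on_differentiable (sf i 0) Vq.
have gE i : (fun q => g q i 0) = fun q => \sum_j pr i j * f q j 0 + - q i 0.
  by apply/funext => q; rewrite !mxE.
have dprf q i : ball 0 e q -> differentiable (fun q => \sum_j pr i j * f q j 0) q.
  move=> Vq; apply: differentiable_sumE => j; apply: differentiableM => //.
  exact: dfi.
have dg i q : `|q - 0| <= rho -> differentiable (fun q => g q i 0) q.
  move=> /rhoV Vq; rewrite gE; apply: differentiableD; first exact: dprf.
  by apply: differentiableN; exact: differentiable_coord.
have gyz : g y = g z.
  apply/matrixP => i j; rewrite (ord1 j); apply/eqP; rewrite -subr_eq0 -normr_le0.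
  have := @pd_lipschitz _ _ (fun q => g q i 0) 0 rho 0 (dg i).
  move=> /(_ _ y z); rewrite mulr0 mul0r; apply.
  - move=> q /rhoV Vq l; rewrite gE pdD; [|exact: dprf|]; last first.
      by apply: differentiableN; exact: differentiable_coord.
    rewrite pdN; last exact: differentiable_coord.
    rewrite pd_coord pd_sum; last first.
      by move=> j'; apply: differentiableM => //; exact: dfi.
    have [U'q jq] := jf q Vq.
    have : (pr *m jac f q) i l = (i == l)%:R by rewrite jq prB// mxE.
    rewrite mxE => <-; rewrite -sumrB big1 ?normr0// => j' _.
    rewrite pdM//; last exact: dfi.
    by rewrite pd_cst mul0r add0r [jac f q _ _]mxE subrr.
  - by rewrite subr0 /rho le_max lexx.
  - by rewrite subr0 /rho le_max lexx orbT.
have : g z = g y by [].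
rewrite /g fyz => /addrI /oppr_inj //.
Qed.

End Leaf.
End InvolutiveProjector.

(** * Bump functions *)

Section Bump.
Context {R : realType}.

(* The derivatives of [exp (-1/t)] are combinations of members of this family. *)
Definition flat_exp (m : nat) (t : R) : R :=
  if 0 < t then t^-1 ^+ m * expR (- t^-1) else 0.

(** The term of degree [m + 2] in the series of [exp (1/t)] yields the bound. Being quadratic in
    [t], it forces the derivative at [0] to vanish. *)
Lemma flat_exp_bound m t : `|flat_exp m t| <= (m.+2)`!%:R * t ^+ 2.
Proof.
rewrite /flat_exp; case: ltP => t0; last first.
  by rewrite normr0 mulr_ge0// sqr_ge0.
have x0 : 0 < t^-1 by rewrite invr_gt0.
rewrite ger0_norm; last by rewrite mulr_ge0// ?exprn_ge0 ?ltW// expR_gt0.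
have H := @expR_ge1Dxn R (t^-1) m.+1 (ltW x0).
rewrite expRN ler_pdivrMr ?expR_gt0//.
have F0 : 0 < (m.+2)`!%:R :> R by rewrite ltr0n fact_gt0.
have : t^-1 ^+ m.+2 / (m.+2)`!%:R <= expR t^-1 by apply: le_trans H; rewrite lerDr.
rewrite ler_pdivrMr// => {}H.
have -> : t^-1 ^+ m = t ^+ 2 * t^-1 ^+ m.+2.
  by rewrite -(addn2 m) exprD mulrCA -exprMn divff ?gt_eqF// expr1n mulr1.
apply: le_trans (ler_wpM2l (sqr_ge0 t) H) _.
by rewrite le_eqVlt; apply/orP; left; apply/eqP; ring.
Qed.

Lemma is_derive_flat_exp m (t : R) :
  is_derive t 1 (flat_exp m) (flat_exp m.+2 t - m%:R * flat_exp m.+1 t).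
Proof.
have [t0|t0|->] := ltgtP t 0.
- rewrite /flat_exp ltNge (ltW t0) /= mulr0 subr0.
  have nt : \forall s \near t, (cst 0 : R -> R) s = flat_exp m s.
    have : t \in `](t - 1), 0[ by rewrite in_itv/= t0 ltrBlDr ltrDl ltr01.
    move=> /near_in_itvoo; apply: filterS => s; rewrite in_itv/= => /andP[_ s0].
    by rewrite /flat_exp ltNge (ltW s0).
  exact: (near_eq_is_derive nt (is_derive_cst _ _ _)).
- have nt : \forall s \near t, (fun s => s^-1 ^+ m * expR (- s^-1)) s = flat_exp m s.
    have : t \in `]0, (t + 1)[ by rewrite in_itv/= t0 ltrDl ltr01.
    move=> /near_in_itvoo; apply: filterS => s; rewrite in_itv/= => /andP[s0 _].
    by rewrite /flat_exp s0.
  apply: (near_eq_is_derive nt).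
  have tn0 : t != 0 by rewrite gt_eqF.
  have dinv : is_derive t 1 (fun s : R => s^-1) (- t^-1 ^+ 2).
    apply: DeriveDef; first by apply: derivableV => //; exact: derivable_id.
    rewrite deriveV//.
    by rewrite derive_id exprVn /GRing.scale /= mulr1.
  have dexp : is_derive t 1 (fun s : R => expR (- s^-1)) (t^-1 ^+ 2 * expR (- t^-1)).
    have := @is_derive1_comp _ expR (fun s => - s^-1) t _ _ _ (is_deriveN dinv).
    rewrite opprK mulrC; apply; exact: is_derive_expR.
  have dpow : is_derive t 1 (fun s : R => s^-1 ^+ m) (- m%:R * t^-1 ^+ m.+1).
    elim: m {nt} => [|m IHm].
      by rewrite oppr0 mul0r; exact: (is_derive_cst (1 : R)).
    rewrite (_ : (fun s => _) = fun s => s^-1 * s^-1 ^+ m); last first.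
      by apply/funext => s; rewrite exprS.
    apply: (is_derive_eq (is_deriveM dinv IHm)).
    by rewrite /GRing.scale /= -natr1 !exprS; ring.
  apply: (is_derive_eq (is_deriveM dpow dexp)).
  by rewrite /flat_exp t0 /GRing.scale /= !exprS; ring.
- have -> : flat_exp m.+2 0 - m%:R * flat_exp m.+1 0 = 0.
    by rewrite /flat_exp ltxx mulr0 subr0.
  pose L : {linear R -> R} := \0.
  have c0 : continuous L by move=> s; exact: cvg_cst.
  have H e : 0 < e -> \forall h \near (0 : R),
      `|flat_exp m (h + 0) - (flat_exp m 0 + L h)| <= e * `|h|.
    move=> e0; pose F : R := (m.+2)`!%:R.
    have F0 : 0 < F by rewrite ltr0n fact_gt0.
    have : \forall h \near (0 : R), `|h| <= e / F.
      apply/nbhs_ballP; exists (e / F) => /=; first exact: divr_gt0.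
      by move=> h; rewrite /ball /= sub0r normrN => /ltW.
    apply: filterS => h; rewrite ler_pdivlMr// => he.
    rewrite addr0 [X in _ - (X + _)]/flat_exp ltxx /= addr0 subr0.
    apply: le_trans (flat_exp_bound _ _) _.
    rewrite -/F -real_normK ?num_real// expr2 mulrA ler_wpM2r//.
    by rewrite mulrC.
  have dh : differentiable (flat_exp m) (0 : R).
    by apply/differentiable_epsP; exists L.
  apply: DeriveDef; first exact: diff_derivable.
  by rewrite deriveE// (diff_epsE (L := L) c0 H).
Qed.

Lemma smooth_flat_exp n (U : set 'cV[R]_n) (psi : 'cV[R]_n -> R) m :
  open U -> smooth_on U psi -> smooth_on U (fun x => flat_exp m (psi x)).
Proof.
(* [m] stays general, because one differentiation raises it by one or two. *)
move=> oU spsi k; elim: k m => [//|k IHk] m.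
have dpsi x : U x -> differentiable psi x.
  by move=> Ux; exact: smooth_on_differentiable spsi Ux.
have dflat x : differentiable (flat_exp m) (psi x).
  by apply/derivable1_diffP; have [] := is_derive_flat_exp m (psi x).
split=> [x Ux|i].
  by apply: (@differentiable_comp _ _ _ _ psi (flat_exp m)) => //; exact: dpsi.
apply: diff_times_ext oU _ (diff_timesM oU (diff_timesD oU (IHk m.+2)
  (diff_timesM oU (diff_times_cst _ _ (- m%:R)) (IHk m.+1)))
  (smooth_on_pd i spsi k)) => x Ux.
rewrite [RHS]/pd [RHS]deriveE; last first.
  by apply: (@differentiable_comp _ _ _ _ psi (flat_exp m)) => //; exact: dpsi.
rewrite (_ : (fun x => flat_exp m (psi x)) = flat_exp m \o psi)//.
rewrite diff_comp//; last exact: dpsi.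
rewrite /= (@diff1E _ _ (flat_exp m))// derive1E.
rewrite (@derive_val _ _ _ _ _ _ _ (is_derive_flat_exp m (psi x))).
by rewrite -deriveE ?mulNr ?[_ *: _]mulrC//; exact: dpsi.
Qed.

(** The function is [exp (-1/psi)] where [psi > 0], normalized at [p], with [psi] equal to [rho^2]
    minus the squared Euclidean distance from [p]. As [psi] is critical at [p], multiplying a
    constant vector by the bump creates no first derivatives there. *)
Lemma bump_function n (p : 'cV[R]_n) (rho : R) : 0 < rho ->
  exists chi : 'cV[R]_n -> R,
    [/\ smooth_on setT chi, chi p = 1, forall i, pd i chi p = 0 &
        forall q, rho <= `|q - p| -> chi q = 0].
Proof.
move=> rho0; pose psi (q : 'cV[R]_n) := rho ^+ 2 - \sum_i (q i 0 - p i 0) ^+ 2.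
pose c := flat_exp 0 (rho ^+ 2).
have c0 : c != 0.
  by rewrite /c /flat_exp exprn_gt0// expr0 mul1r gt_eqF// expR_gt0.
have oT : open [set: 'cV[R]_n] := openT.
have scoord i : smooth_on setT (fun q : 'cV[R]_n => q i 0 - p i 0).
  by apply: smooth_onD => //; [exact: smooth_on_coord | exact: smooth_on_cst].
have ssq i : smooth_on setT (fun q : 'cV[R]_n => (q i 0 - p i 0) ^+ 2).
  apply: smooth_on_ext oT _ (smooth_onM oT (scoord i) (scoord i)) => q _.
  by rewrite expr2.
have spsi : smooth_on setT psi.
  apply: smooth_onD => //; first exact: smooth_on_cst.
  by apply: smooth_onN => //; exact: smooth_on_sum.
have psip : psi p = rho ^+ 2.
  by rewrite /psi big1 ?subr0// => i _; rewrite subrr expr0n.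
have dcoord i q : differentiable (fun q : 'cV[R]_n => q i 0 - p i 0) q.
  exact: smooth_on_differentiable (scoord i) _.
have pdpsi i : pd i psi p = 0.
  rewrite /psi pdD; [|exact: differentiable_cst|]; last first.
    by apply: differentiableN; apply: differentiable_sumE => j;
      exact: smooth_on_differentiable (ssq j) _.
  rewrite pd_cst add0r pdN; last first.
    by apply: differentiable_sumE => j; exact: smooth_on_differentiable (ssq j) _.
  rewrite pd_sum; last by move=> j; exact: smooth_on_differentiable (ssq j) _.
  rewrite big1 ?oppr0// => j _.
  rewrite (_ : (fun q => _) = fun q : 'cV[R]_n => (q j 0 - p j 0) * (q j 0 - p j 0)).
    by rewrite pdM// subrr mul0r mulr0 addr0.
  by apply/funext => q; rewrite expr2.
exists (fun q => c^-1 * flat_exp 0 (psi q)); split.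
- by apply: smooth_onZ => //; exact: smooth_flat_exp.
- by rewrite psip mulVf.
- move=> i; have sf := smooth_flat_exp 0 oT spsi.
  rewrite pdM; [|exact: differentiable_cst|exact: smooth_on_differentiable sf _].
  rewrite pd_cst mul0r add0r.
  have dflat : differentiable (flat_exp 0) (psi p).
    by apply/derivable1_diffP; have [] := is_derive_flat_exp 0 (psi p).
  have dpsi : differentiable psi p by exact: smooth_on_differentiable spsi _.
  rewrite /pd (_ : (fun x => flat_exp 0 (psi x)) = flat_exp 0 \o psi)//.
  rewrite deriveE; last exact: differentiable_comp.
  have d0 : 'd psi p (delta_mx i 0) = 0 by rewrite -deriveE//; exact: pdpsi.
  by rewrite diff_comp//= d0 linear0 mulr0.
- move=> q rq; rewrite /flat_exp ltNge; case: leP => [_|]; first by rewrite mulr0.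
  rewrite /psi subr_gt0 => H; exfalso.
  suff : `|q - p| < rho by rewrite ltNge rq.
  (* The maximum norm is at most the Euclidean norm, so [psi > 0] forces [q] into the open box. *)
  have : `|q - p| <= Num.sqrt (\sum_i (q i 0 - p i 0) ^+ 2).
    apply/mx_norm_leP => [|i j]; first exact: sqrtr_ge0.
    rewrite (ord1 j) !mxE -sqrtr_sqr ler_wsqrtr// (bigD1 i)//= lerDl.
    by apply: sumr_ge0 => l _; exact: sqr_ge0.
  move=> /le_lt_trans; apply.
  rewrite -(ger0_norm (ltW rho0)) -sqrtr_sqr ltr_sqrt// exprn_gt0//.
Qed.

Lemma compact_box n (p : 'cV[R]_n) (rho : R) :
  compact [set q : 'cV[R]_n | `|q - p| <= rho].
Proof.
have ct : continuous (trmx : 'rV[R]_n -> 'cV[R]_n).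
  apply: (@lipschitz_continuous _ _ _ _ 1) => v w; rewrite mul1r -linearB /=.
  by apply/mx_norm_leP => // i j; rewrite mxE le_mx_norm.
have [rho0|rho0] := leP 0 rho; last first.
  rewrite (_ : [set q | _] = set0); first exact: compact0.
  apply/seteqP; split => q //= /(le_trans (normr_ge0 _)).
  by rewrite leNgt rho0.
have := @rV_compact R n (fun i => `[p i 0 - rho, p i 0 + rho]%classic)
  (fun i => @segment_compact R _ _).
move=> /(continuous_compact (continuous_subspaceT ct)).
rewrite (_ : [set _ | _ in _] = [set q : 'cV[R]_n | `|q - p| <= rho])//.
have boxE (q : 'cV[R]_n) : `|q - p| <= rho <->
    forall i, p i 0 - rho <= q i 0 <= p i 0 + rho.
  rewrite (mx_norm_leP _ rho0); split=> [H i|H i j].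
    by have := H i 0; rewrite !mxE ler_distl.
  by rewrite (ord1 j) !mxE ler_distl.
apply/seteqP; split => [_ /= [v Hv <-]|q /= /boxE Hq].
  by apply/boxE => i; have := Hv i; rewrite /= in_itv/= mxE.
exists q^T => /=; last exact: trmxK.
by move=> i; rewrite in_itv/= mxE.
Qed.

End Bump.

(** * Sections with prescribed value at a point *)

Section Sections.
Context {R : realType} {n : nat} {M : topologicalType} (A : manifold R n M).
Implicit Types (a b c : chart A).

Lemma cimgP a x : cimg a x -> cdom a (cinv a x) /\ cmap a (cinv a x) = x.
Proof. by case=> q qa <-; rewrite cmapK. Qed.

Lemma coverlapP a b x : coverlap a b x <-> cimg a x /\ cdom b (cinv a x).
Proof.
split=> [[q [qa qb] <-]|[ax bx]].
  by rewrite cmapK//; split=> //; exists q.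
by have [ax' xE] := cimgP ax; exists (cinv a x).
Qed.

Lemma coverlap_cimg a b : coverlap a b `<=` cimg a.
Proof. by move=> x /coverlapP[]. Qed.

Lemma open_chart_preimage a (O : set M) : open O ->
  open [set x | cimg a x /\ O (cinv a x)].
Proof.
move=> oO; rewrite openE => x /= [ax Ox]; rewrite /interior.
have na : nbhs x (cimg a) by apply: open_nbhs_nbhs; split=> //; exact: cimg_open.
have nO : nbhs x (cinv a @^-1` O).
  by apply: (@cinv_continuous _ _ _ A a x ax); exact: open_nbhs_nbhs.
exact: filterI.
Qed.

Lemma open_coverlap a b : open (coverlap a b).
Proof.
rewrite (_ : coverlap a b = [set x | cimg a x /\ cdom b (cinv a x)]).
  by apply: open_chart_preimage; exact: cdom_open.
by apply/seteqP; split => x /coverlapP.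
Qed.

Lemma cinv_ctrans a b x : coverlap a b x -> cinv b (ctrans a b x) = cinv a x.
Proof. by move=> /coverlapP[_ bx]; rewrite /ctrans cmapK. Qed.

Lemma coverlap_ctrans a b c x : coverlap a b x -> cdom c (cinv a x) ->
  coverlap b c (ctrans a b x).
Proof.
move=> abx cx; apply/coverlapP; rewrite cinv_ctrans//; split=> //.
by exists (cinv a x) => //; have /coverlapP[] := abx.
Qed.

Lemma coverlap_sym a b x : coverlap a b x -> coverlap b a (ctrans a b x).
Proof.
move=> abx; apply: coverlap_ctrans => //.
by have /coverlapP[/cimgP[]] := abx.
Qed.

Lemma ctrans_comp a b c x : coverlap a b x ->
  ctrans b c (ctrans a b x) = ctrans a c x.
Proof. by move=> abx; rewrite {1}/ctrans cinv_ctrans. Qed.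

Lemma ctrans_id a x : cimg a x -> ctrans a a x = x.
Proof. by move=> /cimgP[]. Qed.

Lemma ctransK a b x : coverlap a b x -> ctrans b a (ctrans a b x) = x.
Proof.
by move=> abx; rewrite ctrans_comp// ctrans_id//; exact: coverlap_cimg abx.
Qed.

Lemma smooth_ctrans a b : smooth_mx (coverlap a b) (ctrans a b).
Proof. exact: ctrans_smooth. Qed.

Lemma smooth_transT a b : smooth_mx (coverlap a b) (transT a b).
Proof. by apply: smooth_jac; [exact: open_coverlap | exact: smooth_ctrans]. Qed.

Lemma transT_comp a b c x : coverlap a b x -> cdom c (cinv a x) ->
  transT a c x = transT b c (ctrans a b x) *m transT a b x.
Proof.
move=> abx cx; rewrite /transT -jac_comp.
- apply: near_jac.
  have : nbhs x (coverlap a b) by apply: open_nbhs_nbhs; split=> //; exact: open_coverlap.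
  by apply: filterS => y aby; rewrite ctrans_comp.
- move=> k; apply: (smooth_on_differentiable (@smooth_ctrans b c k 0)).
  exact: coverlap_ctrans.
- move=> k; exact: (smooth_on_differentiable (@smooth_ctrans a b k 0)).
Qed.

Lemma transT_id a x : cimg a x -> transT a a x = 1%:M.
Proof.
move=> ax; apply/matrixP => i j; rewrite !mxE -(pd_coord i j x).
apply: near_pd.
have : nbhs x (cimg a) by apply: open_nbhs_nbhs; split=> //; exact: cimg_open.
by apply: filterS => y /ctrans_id ->.
Qed.

Lemma transTK a b x : coverlap a b x ->
  transT b a (ctrans a b x) *m transT a b x = 1%:M.
Proof.
move=> abx; have ax := coverlap_cimg abx.
by rewrite -transT_comp ?transT_id//; have [] := cimgP ax.
Qed.

Lemma transT_unit a b x : coverlap a b x -> transT a b x \in unitmx.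
Proof. by move=> /transTK /mulmx1_unit[]. Qed.

(* The bump function vanishes outside a compact subset of the domain of [a];
   as [M] is Hausdorff, this subset is closed in [M]. *)
Lemma exists_section_with_value a p (v : 'cV[R]_n) : cimg a p ->
  exists X : components A 'cV[R]_n,
    [/\ smooth_section (@transT R n M A) X, X a p = v & jac (X a) p = 0].
Proof.
move=> ap.
have nap : nbhs p (cimg a) by apply: open_nbhs_nbhs; split=> //; exact: cimg_open.
have [rho rho0 box] := ball_box nap.
have [chi [schi chip dchi chi0]] := @bump_function R n p rho rho0.
pose K := cinv a @` [set q | `|q - p| <= rho].
have clK : closed K.
  apply: compact_closed; first exact: hausdorffM A.
  apply: continuous_compact; last exact: compact_box.
  apply: continuous_in_subspaceT => q; rewrite inE => /box aq.
  exact: (@cinv_continuous _ _ _ A a q aq).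
pose X : components A 'cV[R]_n := fun b y =>
  if `[< cdom a (cinv b y) >] then
    chi (ctrans b a y) *: (transT a b (ctrans b a y) *m v) else 0.
(* In its own chart the field is [chi] times a constant vector; this gives both the value and the
   zero Jacobian at [p]. *)
have Xa y : cimg a y -> X a y = chi y *: v.
  move=> ay; rewrite /X asboolT; last by have [] := cimgP ay.
  by rewrite ctrans_id// transT_id// mul1mx.
exists X; split.
- split=> [b|b c x bcx].
    (* The image of [b] is covered by two open sets: the overlap with [a], where the formula is
       smooth, and the part outside [K], where the field is zero. *)
    move=> i j; apply: smooth_on_local => y by_.
    have [ay|nay] := pselect (cdom a (cinv b y)).
      exists (coverlap b a); first exact/coverlapP.
      have oba := @open_coverlap b a.
      have sF : smooth_mx (coverlap b a)
          (fun y => chi (ctrans b a y) *: (transT a b (ctrans b a y) *m v)).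
        apply: smooth_mxZ => //.
          by apply: (@smooth_on_comp _ _ _ setT _ chi) => //; exact: smooth_ctrans.
        apply: smooth_mxM => //; last exact: smooth_mx_cst.
        apply: (smooth_mx_comp oba _ (@smooth_transT a b) (@smooth_ctrans b a)).
        by move=> z; exact: coverlap_sym.
      apply: (smooth_mx_ext oba _ sF).
      by move=> z /coverlapP[_ az]; rewrite /X asboolT.
    exists [set z | cimg b z /\ (~` K) (cinv b z)].
      split=> //= -[q qK qy]; apply: nay; rewrite -qy.
      by have [] := cimgP (box _ qK).
    have oK : open [set z | cimg b z /\ (~` K) (cinv b z)].
      by apply: open_chart_preimage; rewrite openC.
    apply: (smooth_mx_ext oK _ (smooth_mx_cst _ 0)).
    move=> z [bz nKz]; rewrite /X; case: asboolP => az //.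
    rewrite chi0 ?scale0r// leNgt; apply/negP => /ltW zK; apply: nKz.
    exists (ctrans b a z) => //; apply: cinv_ctrans; exact/coverlapP.
  rewrite /X cinv_ctrans//; case: asboolP => ax; last by rewrite mulmx0.
  rewrite ctrans_comp// -scalemxAr mulmxA; congr (_ *: (_ *m _)).
  have /coverlapP[bx cx] := bcx.
  have bax : coverlap b a x by exact/coverlapP.
  rewrite (@transT_comp a b c) ?ctransK//; first exact: coverlap_sym.
  by rewrite cinv_ctrans.
- by rewrite Xa// chip scale1r.
- apply/matrixP => i j; rewrite !mxE.
  have -> : pd j (fun y => X a y i 0) p = pd j (fun y => chi y * v i 0) p.
    by apply: near_pd; apply: filterS nap => y /Xa ->; rewrite mxE.
  rewrite pdM; [|exact: smooth_on_differentiable schi _|exact: differentiable_cst].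
  by rewrite dchi pd_cst mul0r mulr0 addr0.
Qed.

Section BundleMaps.
Context (m : nat) (g : chart A -> chart A -> 'cV[R]_n -> 'M[R]_m).

Lemma smooth_sectionD X Y : smooth_section g X -> smooth_section g Y ->
  smooth_section g (fun a x => X a x + Y a x).
Proof.
move=> [sX tX] [sY tY]; split=> [a|a b x abx].
  by apply: smooth_mxD => //; exact: cimg_open.
by rewrite tX// tY// mulmxDr.
Qed.

Lemma smooth_sectionZ (k : R) X : smooth_section g X ->
  smooth_section g (fun a x => k *: X a x).
Proof.
move=> [sX tX]; split=> [a|a b x abx].
  by apply: smooth_mxZ => //; [exact: cimg_open | exact: smooth_on_cst].
by rewrite tX// scalemxAr.
Qed.

Lemma smooth_section_endo S X : smooth_endo g S -> smooth_section g X ->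
  smooth_section g (fun a x => S a x *m X a x).
Proof.
move=> [sS tS] [sX tX]; split=> [a|a b x abx].
  by apply: smooth_mxM => //; exact: cimg_open.
by rewrite tX// !mulmxA tS.
Qed.

End BundleMaps.

Lemma smooth_section_col0 X : smooth_section (@transT R n M A) X ->
  smooth_section (@transTT R n M A) (fun a x => col_mx (X a x) 0).
Proof.
move=> [sX tX]; split=> [a i j|a b x abx].
  case: (split_ordP i) => k ->.
    rewrite (_ : (fun x => _) = fun x => X a x k j); first exact: sX.
    by apply/funext => x; rewrite col_mxEu.
  rewrite (_ : (fun x => _) = fun=> 0); first exact: smooth_on_cst.
  by apply/funext => x; rewrite col_mxEd mxE.
by rewrite tX// /transTT mul_block_col !mulmx0 !mul0mx !addr0.
Qed.

End Sections.

(** * Integrability of eigendistributions *)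

Section MatrixAlgebra.
Context {R : realType}.

(** [J] conjugates [P] into the complementary projector, so the two ranks agree, and they add up to
    [m]. The rank is thus determined by the dimension and cannot vary from point to point. *)
Lemma rank_anticommuting_projectors m (P J : 'M[R]_m) :
  P *m P = P -> J \in unitmx -> J *m P = (1%:M - P) *m J ->
  (\rank P + \rank P)%N = m.
Proof.
move=> PP uJ JP.
have PQ : \rank (1%:M - P) = \rank P.
  rewrite -(mxrankMfree (1%:M - P) (B := J)) ?row_free_unit// -JP.
  by rewrite (eqmxMfull P (A := J)) ?row_full_unit.
apply/eqP; rewrite eqn_leq; apply/andP; split.
  rewrite -{2}PQ; apply: mulmx0_rank_max.
  by rewrite mulmxBr mulmx1 PP subrr.
have := mxrank_add P (1%:M - P).
by rewrite [P + _]addrC subrK mxrank1 PQ.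
Qed.

Lemma square_opp1_unit m (J : 'M[R]_m) : J *m J = - 1%:M -> J \in unitmx.
Proof.
move=> JJ; have : J *m (- J) = 1%:M by rewrite mulmxN JJ opprK.
by case/mulmx1_unit.
Qed.

(** [(r + 1) J = - J (r - 1)] with [J] invertible. *)
Lemma rank_eigenspaces_anticommute m (r J : 'M[R]_m) :
  J *m J = - 1%:M -> r *m J = - (J *m r) ->
  \rank (col_eigenspace r 1) = \rank (col_eigenspace r (-1)).
Proof.
move=> JJ rJ; have uJ := square_opp1_unit JJ.
rewrite /col_eigenspace /eigenspace !mxrank_ker; congr (_ - _)%N.
have trE (c : R) : \rank (r^T - c%:M) = \rank (r - c%:M).
  by rewrite -mxrank_tr linearB /= trmxK tr_scalar_mx.
rewrite !trE -(mxrankMfree (r - (-1)%:M) (B := J)) ?row_free_unit//.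
have -> : (r - (-1)%:M) *m J = - (J *m (r - 1%:M)).
  by rewrite mulmxBl mulmxBr rJ mulmx1 raddfN /= mulNmx mul1mx opprK opprB addrC.
by rewrite mxrank_opp (eqmxMfull _ (A := J)) ?row_full_unit.
Qed.

End MatrixAlgebra.

Section Brackets.
Context {R : realType}.

Lemma jac_mulmx n m (F : 'cV[R]_n -> 'cV[R]_m) y w :
  jac F y *m w = mxderiv F y w.
Proof.
apply/matrixP => i j; rewrite !mxE; apply: eq_bigr => l _.
by rewrite !mxE (ord1 j).
Qed.

Lemma mxderiv_mul_constant_jet n m (F : 'cV[R]_n -> 'M[R]_(m, n))
    (xi : 'cV[R]_n -> 'cV[R]_n) p w :
  (forall i j, differentiable (fun y => F y i j) p) ->
  (forall i, differentiable (fun y => xi y i 0) p) -> jac xi p = 0 ->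
  mxderiv (fun y => F y *m xi y) p w = mxderiv F p w *m xi p.
Proof.
move=> dF dxi jxi.
rewrite mxderivM//; last by move=> i j; rewrite (ord1 j); exact: dxi.
by rewrite -(jac_mulmx xi) jxi mul0mx mulmx0 addr0.
Qed.

(** The right-hand side is the expression on which [involutive_projector_leaf] imposes involutivity,
    evaluated at [eta p] and [xi p]. *)
Lemma lie_bracket_projections n (P : 'cV[R]_n -> 'M[R]_n)
    (xi eta : 'cV[R]_n -> 'cV[R]_n) p :
  (forall i j, differentiable (fun y => P y i j) p) ->
  (forall i, differentiable (fun y => xi y i 0) p) -> jac xi p = 0 ->
  (forall i, differentiable (fun y => eta y i 0) p) -> jac eta p = 0 ->
  lie_bracket (fun y => P y *m xi y) (fun y => P y *m eta y) p =
  mxderiv P p (P p *m xi p) *m eta p - mxderiv P p (P p *m eta p) *m xi p.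
Proof.
move=> dP dxi jxi deta jeta.
by rewrite /lie_bracket !jac_mulmx !mxderiv_mul_constant_jet.
Qed.

End Brackets.

Section Integrability.
Context {R : realType} {n : nat} {M : topologicalType} (A : manifold R n M).

Lemma smooth_cimg_differentiable p q (F : components A 'M[R]_(p, q)) a x :
  (forall a, smooth_mx (cimg a) (F a)) -> cimg a x ->
  forall i j, differentiable (fun y => F a y i j) x.
Proof.
by move=> sF ax i j; exact: smooth_on_differentiable (sF a i j) ax.
Qed.

Lemma closed_eigenbundle_integrable (r j : components A 'M[R]_n) (e : R) :
  e * e = 1 ->
  smooth_endo (@transT R n M A) r ->
  everywhere (fun a x => r a x *m r a x = 1%:M) ->
  everywhere (fun a x => j a x *m j a x = - 1%:M) ->
  anticommute r j ->
  closed_eigenbundle (@transT R n M A) lie_bracket r e ->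
  integrable_distribution (eigendistribution r e).
Proof.
move=> ee [sr tr] rr jj rj clr a x ax.
(* The projector onto the [e]-eigendistribution; [e * e = 1] covers both signs. *)
pose P (a : chart A) y : 'M[R]_n := 2^-1 *: (1%:M + e *: r a y).
have two : (2 : R) != 0 by rewrite pnatr_eq0.
have half (V : lmodType R) (v : V) : 2^-1 *: (v + v) = v.
  by rewrite -(mulr2n v) -(scaler_nat 2 v) scalerA mulVf// scale1r.
have sP b : smooth_mx (cimg b) (P b).
  apply: smooth_mxZ; [exact: cimg_open|exact: smooth_on_cst|].
  apply: smooth_mxD; [exact: cimg_open|exact: smooth_mx_cst|].
  by apply: smooth_mxZ; [exact: cimg_open|exact: smooth_on_cst|exact: sr].
have rP b y : cimg b y -> r b y *m P b y = e *: P b y.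
  move=> by_; rewrite /P -scalemxAr mulmxDr mulmx1 -scalemxAr rr//.
  rewrite [RHS]scalerA [e * _]mulrC -[RHS]scalerA [in RHS]scalerDr.
  by rewrite [in RHS]scalerA ee scale1r addrC.
have fixP b y (v : 'cV[R]_n) : cimg b y -> P b y *m v = v <-> r b y *m v = e *: v.
  move=> by_; split=> [<-|rv]; first by rewrite mulmxA rP// scalemxAl.
  rewrite /P -scalemxAl mulmxDl mul1mx -scalemxAl rv scalerA ee scale1r.
  exact: half.
have PP b y : cimg b y -> P b y *m P b y = P b y.
  move=> by_; rewrite {1}/P -scalemxAl mulmxDl mul1mx -scalemxAl rP// scalerA ee.
  by rewrite scale1r; exact: half.
have PC b y : 1%:M - P b y = 2^-1 *: (1%:M - e *: r b y).
  apply/matrixP => i k; rewrite !mxE; by field.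
have rankP b y : cimg b y -> (\rank (P b y) + \rank (P b y))%N = n.
  move=> by_; apply: (rank_anticommuting_projectors (J := j b y)) => //.
  - exact: PP.
  - exact/square_opp1_unit/jj.
  - rewrite PC /P -scalemxAl -scalemxAr mulmxDr mulmxBl mulmx1 mul1mx.
    by rewrite -scalemxAr -scalemxAl rj// scalerN opprK.
have involP y : cimg a y -> forall u v : 'cV[R]_n,
    (1%:M - P a y) *m (mxderiv (P a) y (P a y *m u) *m v
                       - mxderiv (P a) y (P a y *m v) *m u) = 0.
  move=> ay u v.
  (* After projection by [P], these extensions of [u] and [v] are global sections of the
     eigenbundle, and their bracket at [y] is the involutivity expression. *)
  have [X [sX Xu jX]] := exists_section_with_value u ay.
  have [Y [sY Yv jY]] := exists_section_with_value v ay.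
  have sPs Z : smooth_section (@transT R n M A) Z ->
      smooth_section (@transT R n M A) (fun b z => P b z *m Z b z).
    move=> sZ; have := smooth_sectionZ 2^-1 (smooth_sectionD sZ
      (smooth_sectionZ e (smooth_section_endo (conj sr tr) sZ))).
    congr smooth_section; apply/funext => b; apply/funext => z.
    by rewrite /P -scalemxAl mulmxDl mul1mx -scalemxAl.
  have ePs Z : in_eigenbundle r e (fun b z => P b z *m Z b z).
    by move=> b z bz; rewrite mulmxA rP// scalemxAl.
  have := clr _ _ (sPs _ sX) (sPs _ sY) (ePs X) (ePs Y) a y ay.
  rewrite lie_bracket_projections//.
  - rewrite Xu Yv => /(fixP _ _ _ ay) PZ.
    by rewrite mulmxBl mul1mx PZ subrr.
  - exact: smooth_cimg_differentiable.
  - by move=> i; apply: smooth_cimg_differentiable => //; case: sX.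
  - by move=> i; apply: smooth_cimg_differentiable => //; case: sY.
have rankE y : cimg a y -> \rank (P a y) = \rank (P a x).
  move=> ay; apply/eqP; rewrite -(eqn_pmul2l (isT : (0 < 2)%N)) !mul2n -!addnn.
  by rewrite !rankP.
have oa : open (cimg a) := @cimg_open _ _ _ A a.
have [eps [f [e0 f0 sf injf Hf]]] :=
  involutive_projector_leaf oa ax (sP a) (PP a) rankE involP.
exists (\rank (P a x)), (ball 0 eps), f; split=> //.
- by split=> //; exact: ball_open.
- by split=> //; exact: ballxx.
- by move=> _ [y Vy <-]; have [] := Hf y Vy.
- move=> y Vy; have [ay rf imf] := Hf y Vy; split=> //.
  apply/seteqP; split => [v /(fixP _ _ _ ay) /imf[w <-]|_ [w _ <-]].
    by exists w.
  by apply/(fixP _ _ _ ay)/imf; exists w.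
Qed.

End Integrability.

(** * Block-diagonal and block-antidiagonal structures *)

Section Complexification.
Context {R : realType}.

Lemma complexifyM p q r (A : 'M[R]_(p, q)) (B : 'M[R]_(q, r)) :
  complexify (A *m B) = complexify A *m complexify B.
Proof. exact: (map_mxM (real_complex R)). Qed.

Lemma complexifyN p q (A : 'M[R]_(p, q)) : complexify (- A) = - complexify A.
Proof. exact: (map_mxN (real_complex R)). Qed.

Lemma complexify_block p q r s (A : 'M[R]_(p, r)) (B : 'M[R]_(p, s))
    (C : 'M[R]_(q, r)) (D : 'M[R]_(q, s)) :
  complexify (block_mx A B C D) =
  block_mx (complexify A) (complexify B) (complexify C) (complexify D).
Proof. exact: map_block_mx. Qed.

Lemma complexify0 p q : complexify (0 : 'M[R]_(p, q)) = 0.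
Proof. exact: (map_mx0 (real_complex R)). Qed.

Lemma usubmx_complex_combination p q r (a b c d : 'M[R]_(p + q, r)) :
  usubmx (complexify (a - b) + 'i%C *: complexify (c + d)) =
  complexify (usubmx a - usubmx b) + 'i%C *: complexify (usubmx c + usubmx d).
Proof. by apply/matrixP => i j; rewrite !mxE. Qed.

Definition cplx_col m (a b : 'cV[R]_m) : 'cV[R[i]]_m :=
  complexify a + 'i%C *: complexify b.

Lemma cplx_col_Re m (a b : 'cV[R]_m) :
  map_mx (@complex.Re R) (cplx_col a b) = a.
Proof. by apply/matrixP => i j; rewrite !mxE /=; ring. Qed.

Lemma cplx_col_Im m (a b : 'cV[R]_m) :
  map_mx (@complex.Im R) (cplx_col a b) = b.
Proof. by apply/matrixP => i j; rewrite !mxE /=; ring. Qed.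

(** Separation of real and imaginary parts. The eigenvalue is [-i] because, when [S] squares to
    [-1], the vectors [X + i S X] belong to it. *)
Lemma cplx_col_eigen m (S : 'M[R]_m) (a b : 'cV[R]_m) :
  complexify S *m cplx_col a b = (- 'i%C) *: cplx_col a b <->
  S *m a = b /\ S *m b = - a.
Proof.
have -> : complexify S *m cplx_col a b = cplx_col (S *m a) (S *m b).
  by rewrite /cplx_col mulmxDr -scalemxAr !complexifyM.
have -> : (- 'i%C) *: cplx_col a b = cplx_col b (- a).
  rewrite /cplx_col scalerDr scalerA complexifyN scalerN scaleNr addrC.
  congr (_ + _); rewrite mulNr -expr2 sqr_i opprK scale1r //.
split=> [H|[-> ->]//]; split.
  by have := congr1 (map_mx (@complex.Re R)) H; rewrite !cplx_col_Re.
by have := congr1 (map_mx (@complex.Im R)) H; rewrite !cplx_col_Im.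
Qed.

End Complexification.

Section DiagonalStructures.
Context {R : realType} {n : nat} {M : topologicalType} (A : manifold R n M).
Implicit Types r t : components A 'M[R]_n.

Lemma usubmx_diag_block (F : fieldType) (r t : 'M[F]_n) (Z : 'cV[F]_(n + n)) :
  usubmx (block_mx r 0 0 t *m Z) = r *m usubmx Z.
Proof. by rewrite -{1}(vsubmxK Z) mul_block_col col_mxKu mul0mx addr0. Qed.

Lemma smooth_endo_diag_block r t :
  smooth_endo (@transTT R n M A) (diag_block r t) -> smooth_endo (@transT R n M A) r.
Proof.
move=> [sS tS]; split=> [a i j|a b x abx].
  have := sS a (lshift n i) (lshift n j).
  by congr smooth_on; apply/funext => x; rewrite block_mxEul.
have := tS a b x abx; rewrite /diag_block /transTT !mulmx_block.
rewrite !mulmx0 !mul0mx !addr0 => /eq_block_mx[]//.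
Qed.

Lemma diag_block_square r t (s : R) :
  everywhere (fun a x => diag_block r t a x *m diag_block r t a x = s%:M) ->
  everywhere (fun a x => r a x *m r a x = s%:M).
Proof.
move=> H a x ax; have := H a x ax; rewrite /diag_block mulmx_block.
by rewrite !mulmx0 !addr0 scalar_mx_block => /eq_block_mx[].
Qed.

Lemma diag_block_anticommute l (j r t : components A 'M[R]_n) :
  anticommute (diag_block r t) (J_l l j) -> anticommute r j.
Proof.
move=> H a x ax; have := H a x ax; rewrite /diag_block /J_l !mulmx_block.
by rewrite !mulmx0 !mul0mx !addr0 opp_block_mx => /eq_block_mx[].
Qed.

Lemma usubmx_courant_bracket (U V : 'cV[R]_n -> 'cV[R]_(n + n)) x :
  usubmx (courant_bracket U V x) =
  lie_bracket (fun y => usubmx (U y)) (fun y => usubmx (V y)) x.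
Proof. by rewrite /courant_bracket col_mxKu. Qed.

Lemma usubmx_complex_courant_bracket (Z W : 'cV[R]_n -> 'cV[R[i]]_(n + n)) x :
  usubmx (C_bilinear_ext courant_bracket Z W x) =
  C_bilinear_ext lie_bracket (fun y => usubmx (Z y)) (fun y => usubmx (W y)) x.
Proof.
have reE (V : 'cV[R]_n -> 'cV[R[i]]_(n + n)) :
    re_field (fun y => usubmx (V y)) = fun y => usubmx (re_field V y).
  by apply/funext => y; apply/matrixP => i k; rewrite !mxE.
have imE (V : 'cV[R]_n -> 'cV[R[i]]_(n + n)) :
    im_field (fun y => usubmx (V y)) = fun y => usubmx (im_field V y).
  by apply/funext => y; apply/matrixP => i k; rewrite !mxE.
rewrite /C_bilinear_ext usubmx_complex_combination !reE !imE.
by congr (complexify (_ - _) + _ *: complexify (_ + _));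
  exact: usubmx_courant_bracket.
Qed.

Lemma closed_diag_block r t e :
  closed_eigenbundle (@transTT R n M A) courant_bracket (diag_block r t) e ->
  closed_eigenbundle (@transT R n M A) lie_bracket r e.
Proof.
move=> H X Y sX sY eX eY a x ax.
have eC Z : in_eigenbundle r e Z ->
    in_eigenbundle (diag_block r t) e (fun a x => col_mx (Z a x) 0).
  move=> eZ b y by_; rewrite /diag_block mul_block_col !mul0mx mulmx0 !addr0.
  by rewrite eZ// scale_col_mx scaler0.
have := H _ _ (smooth_section_col0 sX) (smooth_section_col0 sY) (eC _ eX) (eC _ eY) a x ax.
move=> /(congr1 usubmx).
rewrite usubmx_diag_block linearZ /= usubmx_courant_bracket.
have E (Z : components A 'cV[R]_n) :
    (fun y => usubmx (col_mx (Z a y) (0 : 'cV[R]_n))) = Z a.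
  by apply/funext => y; rewrite col_mxKu.
by rewrite !E.
Qed.

Lemma closed_complex_diag_block r t e :
  closed_complex_eigenbundle (@transTT R n M A) courant_bracket (diag_block r t) e ->
  closed_complex_eigenbundle (@transT R n M A) lie_bracket r e.
Proof.
move=> H X Y sX sY eX eY a x ax.
pose col0 (Z : components A 'cV[R[i]]_n) : components A 'cV[R[i]]_(n + n) :=
  fun a x => col_mx (Z a x) 0.
have reC Z b : re_field (col0 Z b) = fun y => col_mx (re_field (Z b) y) 0.
  by apply/funext => y; rewrite /re_field /col0 map_col_mx map_mx0.
have imC Z b : im_field (col0 Z b) = fun y => col_mx (im_field (Z b) y) 0.
  by apply/funext => y; rewrite /im_field /col0 map_col_mx map_mx0.
have sC Z : smooth_complex_section (@transT R n M A) Z ->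
    smooth_complex_section (@transTT R n M A) (col0 Z).
  move=> [sre sim]; split.
    have := smooth_section_col0 sre; congr smooth_section.
    by apply/funext => b; rewrite reC.
  have := smooth_section_col0 sim; congr smooth_section.
  by apply/funext => b; rewrite imC.
have eC Z : in_complex_eigenbundle r e Z ->
    in_complex_eigenbundle (diag_block r t) e (col0 Z).
  move=> eZ b y by_; rewrite /diag_block complexify_block !complexify0 mul_block_col.
  by rewrite !mul0mx mulmx0 !addr0 eZ// scale_col_mx scaler0.
have := H _ _ (sC _ sX) (sC _ sY) (eC _ eX) (eC _ eY) a x ax.
move=> /(congr1 usubmx).
rewrite /diag_block complexify_block !complexify0 usubmx_diag_block linearZ /=.
suff -> : usubmx (C_bilinear_ext courant_bracket (col0 X a) (col0 Y a) x) =
    C_bilinear_ext lie_bracket (X a) (Y a) x by [].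
have XE (Z : components A 'cV[R[i]]_n) : (fun y => usubmx (col0 Z a y)) = Z a.
  by apply/funext => y; rewrite /col0 col_mxKu.
by rewrite usubmx_complex_courant_bracket (XE X) (XE Y).
Qed.

End DiagonalStructures.

(** * Covector part of the Courant bracket and the exterior derivative *)

Section TwoForms.
Context {R : realType} {n : nat}.
Implicit Types (F : 'cV[R]_n -> 'M[R]_n) (xi eta : 'cV[R]_n -> 'cV[R]_n).

Lemma mulmx_delta_entry p q (A : 'M[R]_(p, q)) i j : (A *m delta_mx j 0 : 'cV_p) i 0 = A i j.
Proof. by rewrite -colE mxE. Qed.

Lemma mxderiv_delta p q (F : 'cV[R]_n -> 'M[R]_(p, q)) y l i j :
  mxderiv F y (delta_mx l 0) i j = pd l (fun z => F z i j) y.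
Proof.
rewrite mxE (bigD1 l)//= !mxE !eqxx mulr1 big1 ?addr0// => k kl.
by rewrite !mxE (negbTE kl) mulr0.
Qed.

Lemma bil_delta (W : 'M[R]_n) i j : bil W (delta_mx i 0) (delta_mx j 0) = W i j.
Proof. by rewrite /bil trmx_delta -mulmxA -rowE mxE mulmx_delta_entry. Qed.

Lemma lie_deriv_constant_jet F xi eta p :
  (forall i j, differentiable (fun y => F y i j) p) ->
  (forall i, differentiable (fun y => eta y i 0) p) ->
  jac xi p = 0 -> jac eta p = 0 ->
  lie_deriv xi (fun y => F y *m eta y) p = mxderiv F p (xi p) *m eta p.
Proof.
move=> dF deta jxi jeta.
by rewrite /lie_deriv jxi trmx0 mul0mx addr0 jac_mulmx mxderiv_mul_constant_jet.
Qed.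

Lemma differentiable_mulmx_col F eta p i :
  (forall i j, differentiable (fun y => F y i j) p) ->
  (forall i, differentiable (fun y => eta y i 0) p) ->
  differentiable (fun y => (F y *m eta y) i 0) p.
Proof.
move=> dF deta; rewrite (_ : (fun y => _) = fun y => \sum_k F y i k * eta y k 0).
  by apply: differentiable_sumE => k; apply: differentiableM.
by apply/funext => y; rewrite mxE.
Qed.

Lemma pairingE (s u : 'cV[R]_n) : pairing s u = \sum_k s k 0 * u k 0.
Proof. by rewrite /pairing mxE; apply: eq_bigr => k _; rewrite mxE. Qed.

Lemma differentiable_pairing F xi eta p :
  (forall i j, differentiable (fun y => F y i j) p) ->
  (forall i, differentiable (fun y => xi y i 0) p) ->
  (forall i, differentiable (fun y => eta y i 0) p) ->
  differentiable (fun y => pairing (F y *m eta y) (xi y)) p.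
Proof.
move=> dF dxi deta.
rewrite (_ : (fun y => _) = fun y => \sum_k (F y *m eta y) k 0 * xi y k 0).
  apply: differentiable_sumE => k; apply: differentiableM => //.
  exact: differentiable_mulmx_col.
by apply/funext => y; rewrite pairingE.
Qed.

Lemma pd_pairing_constant_jet F xi eta p l :
  (forall i j, differentiable (fun y => F y i j) p) ->
  (forall i, differentiable (fun y => xi y i 0) p) ->
  (forall i, differentiable (fun y => eta y i 0) p) ->
  jac xi p = 0 -> jac eta p = 0 ->
  pd l (fun y => pairing (F y *m eta y) (xi y)) p =
  pairing (mxderiv F p (delta_mx l 0) *m eta p) (xi p).
Proof.
move=> dF dxi deta jxi jeta.
have dFeta k := differentiable_mulmx_col k dF deta.
rewrite (_ : (fun y => _) = fun y => \sum_k (F y *m eta y) k 0 * xi y k 0).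
  rewrite pd_sum; last by move=> k; apply: differentiableM.
  rewrite pairingE; apply: eq_bigr => k _; rewrite pdM//.
  have -> : pd l (fun y => xi y k 0) p = 0.
    by have := congr1 (fun J : 'M[R]_n => J k l) jxi; rewrite !mxE.
  rewrite mulr0 addr0; congr (_ * _).
  rewrite -(mxderiv_mul_constant_jet _ dF deta jeta) mxderiv_delta//.
by apply/funext => y; rewrite pairingE.
Qed.

(* The left-hand side is the covector part of the Courant bracket of the
   sections [xi + F xi] and [eta + F eta]. *)
Lemma bracket_covector_entry F xi eta p i j k :
  (forall i j, differentiable (fun y => F y i j) p) ->
  (forall i, differentiable (fun y => xi y i 0) p) ->
  (forall i, differentiable (fun y => eta y i 0) p) ->
  xi p = delta_mx i 0 -> jac xi p = 0 -> eta p = delta_mx j 0 -> jac eta p = 0 ->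
  (lie_deriv xi (fun y => F y *m eta y) p
   - lie_deriv eta (fun y => F y *m xi y) p
   - 2^-1 *: grad (fun y => pairing (F y *m eta y) (xi y)
                            - pairing (F y *m xi y) (eta y)) p) k 0 =
  pd i (fun y => F y k j) p - pd j (fun y => F y k i) p
  - 2^-1 * (pd k (fun y => F y i j) p - pd k (fun y => F y j i) p).
Proof.
move=> dF dxi deta xip jxi etap jeta.
rewrite !lie_deriv_constant_jet// xip etap.
rewrite [LHS]mxE [X in X + _]mxE [X in _ + X]mxE [X in _ - X]mxE.
rewrite !mulmx_delta_entry !mxderiv_delta [grad _ _ _ _]mxE pdD; last first.
- by apply: differentiableN; exact: differentiable_pairing.
- exact: differentiable_pairing.
rewrite pdN; last exact: differentiable_pairing.
rewrite !pd_pairing_constant_jet// xip etap.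
have pd_entry l i' j' : pairing (mxderiv F p (delta_mx l 0) *m delta_mx j' 0)
    (delta_mx i' 0) = pd l (fun y => F y i' j') p.
  rewrite pairingE (bigD1 i')//= mulmx_delta_entry mxderiv_delta mxE !eqxx mulr1.
  by rewrite big1 ?addr0// => m mi; rewrite [delta_mx _ _ _ _]mxE (negbTE mi) mulr0.
rewrite !pd_entry; congr (_ + _ - _).
by rewrite mxE mulmx_delta_entry mxderiv_delta.
Qed.

End TwoForms.

Lemma courant_bracket_col {R : realType} n (u s v t : 'cV[R]_n -> 'cV[R]_n) x :
  courant_bracket (fun y => col_mx (u y) (s y)) (fun y => col_mx (v y) (t y)) x =
  col_mx (lie_bracket u v x)
    (lie_deriv u t x - lie_deriv v s x
     - 2^-1 *: grad (fun y => pairing (t y) (u y) - pairing (s y) (v y)) x).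
Proof.
have uE (f g : 'cV[R]_n -> 'cV[R]_n) : (fun y => usubmx (col_mx (f y) (g y))) = f.
  by apply/funext => y; rewrite col_mxKu.
have dE (f g : 'cV[R]_n -> 'cV[R]_n) : (fun y => dsubmx (col_mx (f y) (g y))) = g.
  by apply/funext => y; rewrite col_mxKd.
have gE : (fun y => pairing (dsubmx (col_mx (v y) (t y))) (usubmx (col_mx (u y) (s y)))
    - pairing (dsubmx (col_mx (u y) (s y))) (usubmx (col_mx (v y) (t y)))) =
    (fun y => pairing (t y) (u y) - pairing (s y) (v y)).
  by apply/funext => y; rewrite !col_mxKu !col_mxKd.
by rewrite /courant_bracket gE (uE u s) (uE v t) (dE u s) (dE v t).
Qed.

Lemma jac_cst {R : realType} m n (c : 'cV[R]_m) (x : 'cV[R]_n) :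
  jac (fun=> c) x = 0.
Proof. by apply/matrixP => i j; rewrite !mxE pd_cst. Qed.

Lemma gradD {R : realType} n (f g : 'cV[R]_n -> R) x :
  differentiable f x -> differentiable g x ->
  grad (fun y => f y + g y) x = grad f x + grad g x.
Proof. by move=> df dg; apply/matrixP => i j; rewrite !mxE pdD. Qed.

Section AntidiagonalStructures.
Context {R : realType} {n : nat} {M : topologicalType} (A : manifold R n M).
Implicit Types p w : components A 'M[R]_n.

Lemma antidiag_block_col p w a x (u s : 'cV[R]_n) :
  antidiag_block p w a x *m col_mx u s = col_mx (p a x *m s) (flat (w a x) *m u).
Proof. by rewrite /antidiag_block mul_block_col !mul0mx add0r addr0. Qed.

Lemma pairing_flat (W : 'M[R]_n) u v : pairing (flat W *m u) v = bil W u v.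
Proof. by rewrite /pairing /bil /flat trmx_mul trmxK. Qed.

Lemma antidiag_block_skew p w :
  everywhere (fun a x => forall X Y,
    split_form (antidiag_block p w a x *m X) Y
    = - split_form X (antidiag_block p w a x *m Y)) ->
  everywhere (fun a x => forall u v, bil (w a x) u v = - bil (w a x) v u).
Proof.
move=> H a x ax u v; have := H a x ax (col_mx u 0) (col_mx v 0).
rewrite !antidiag_block_col !mulmx0 /split_form !col_mxKu !col_mxKd !pairing_flat.
by rewrite /pairing !mulmx0 !mxE add0r addr0.
Qed.

Lemma antidiag_block_square p w (s : R) :
  everywhere (fun a x => antidiag_block p w a x *m antidiag_block p w a x = s%:M) ->
  everywhere (fun a x => p a x *m flat (w a x) = s%:M /\ flat (w a x) *m p a x = s%:M).
Proof.
move=> H a x ax; have := H a x ax; rewrite /antidiag_block mulmx_block.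
by rewrite !mulmx0 !mul0mx !addr0 !add0r scalar_mx_block => /eq_block_mx[].
Qed.

Lemma antidiag_block_nondegenerate p w (s : R) : s != 0 ->
  everywhere (fun a x => antidiag_block p w a x *m antidiag_block p w a x = s%:M) ->
  everywhere (fun a x => forall u, (forall v, bil (w a x) u v = 0) -> u = 0).
Proof.
move=> s0 /antidiag_block_square H a x ax u uv; have [pw _] := H a x ax.
have Fu : flat (w a x) *m u = 0.
  apply/matrixP => i k; rewrite (ord1 k) [RHS]mxE -(uv (delta_mx i 0)).
  rewrite -pairing_flat pairingE (bigD1 i)//= [delta_mx _ _ _ _]mxE !eqxx mulr1.
  by rewrite big1 ?addr0// => l li; rewrite [delta_mx _ _ _ _]mxE (negbTE li) mulr0.
have : s *: u = 0 by rewrite -mul_scalar_mx -pw -mulmxA Fu mulmx0.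
by move/eqP; rewrite scaler_eq0 (negbTE s0) => /eqP.
Qed.

(** With [T] the transition matrix of the tangent bundle, the lower left blocks give that [flat w]
    in the chart [b], times [T], is the inverse transpose of [T] times [flat w] in the chart [a].
    Multiplication by the transpose of [T] yields the transformation law of a bilinear form. *)
Lemma antidiag_block_smooth p w :
  smooth_endo (@transTT R n M A) (antidiag_block p w) ->
  (forall a, smooth_mx (cimg a) (w a)) /\
  (forall a b x, coverlap a b x -> forall u v,
     bil (w b (ctrans a b x)) (transT a b x *m u) (transT a b x *m v)
     = bil (w a x) u v).
Proof.
move=> [sS tS]; split=> [a i j|a b x abx u v].
  have := sS a (rshift n j) (lshift n i).
  by congr smooth_on; apply/funext => x; rewrite block_mxEdl mxE.
have := tS a b x abx; rewrite /antidiag_block /transTT !mulmx_block.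
rewrite !mulmx0 !mul0mx !addr0 !add0r => /eq_block_mx[_ _ H _].
have uT := transT_unit abx.
have : (transT a b x)^T *m (flat (w b (ctrans a b x)) *m transT a b x) = flat (w a x).
  by rewrite H mulmxA -trmx_mul mulVmx// trmx1 mul1mx.
move/(congr1 trmx); rewrite /flat !trmx_mul !trmxK => <-.
by rewrite /bil trmx_mul !mulmxA.
Qed.

Lemma antidiag_block_anticommute l (j p w : components A 'M[R]_n) :
  anticommute (antidiag_block p w) (J_l l j) ->
  everywhere (fun a x => forall u v,
    bil (w a x) (j a x *m u) v
    = - (sval_sign R l * bil (w a x) u (j a x *m v))).
Proof.
move=> H a x ax u v; have := H a x ax.
rewrite /antidiag_block /J_l !mulmx_block !mulmx0 !mul0mx !addr0 !add0r.
rewrite opp_block_mx => /eq_block_mx[_ _ /(congr1 trmx) + _].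
rewrite /flat linearN /= !trmx_mul trmxK linearZ /= trmxK => E.
rewrite /bil trmx_mul -(mulmxA u^T) E mulmxN mulNmx mxE.
by rewrite -!scalemxAr -!scalemxAl mxE !mulmxA.
Qed.

Section Closedness.
Variables (p w : components A 'M[R]_n).
Hypothesis sS : smooth_endo (@transTT R n M A) (antidiag_block p w).
Hypothesis skew : everywhere (fun a x => forall u v, bil (w a x) u v = - bil (w a x) v u).
Variable s : R.
Hypothesis SS : everywhere (fun a x =>
  antidiag_block p w a x *m antidiag_block p w a x = s%:M).

Let F a y := flat (w a y).

Let lower a (xi eta : 'cV[R]_n -> 'cV[R]_n) x :=
  lie_deriv xi (fun y => F a y *m eta y) x - lie_deriv eta (fun y => F a y *m xi y) x
  - 2^-1 *: grad (fun y => pairing (F a y *m eta y) (xi y)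
                            - pairing (F a y *m xi y) (eta y)) x.

(** The reduction shared by the real and the complex case. Test fields with zero Jacobian at [x]
    have zero Lie bracket there, so a bracket lying in the graph of [F] has covector part [F 0 = 0];
    on coordinate vectors this part is a component of [d omega]. *)
Let closed_of_lower :
  (forall X Y, smooth_section (@transT R n M A) X -> smooth_section (@transT R n M A) Y ->
     forall a x, cimg a x -> lie_bracket (X a) (Y a) x = 0 -> lower a (X a) (Y a) x = 0) ->
  everywhere (fun a x => forall i k l,
    pd i (fun y => w a y k l) x + pd k (fun y => w a y l i) x
    + pd l (fun y => w a y i k) x = 0).
Proof.
move=> H a x ax i k l.
have [sw _] := antidiag_block_smooth sS.
have [X [sX Xi jX]] := exists_section_with_value (delta_mx i 0) ax.
have [Y [sY Yk jY]] := exists_section_with_value (delta_mx k 0) ax.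
have L0 : lower a (X a) (Y a) x = 0.
  by apply: H => //; rewrite /lie_bracket jX jY !mul0mx subrr.
have dw i' j' : differentiable (fun y => w a y i' j') x.
  exact: smooth_cimg_differentiable.
have FE i' j' : (fun y => F a y i' j') = fun y => w a y j' i'.
  by apply/funext => y; rewrite mxE.
have dF i' j' : differentiable (fun y => F a y i' j') x by rewrite FE.
have dX i' : differentiable (fun y => X a y i' 0) x.
  by apply: smooth_cimg_differentiable => //; case: sX.
have dY i' : differentiable (fun y => Y a y i' 0) x.
  by apply: smooth_cimg_differentiable => //; case: sY.
have := bracket_covector_entry l dF dX dY Xi jX Yk jY.
rewrite -/(lower a (X a) (Y a) x) L0 mxE !FE.
have skew_pd m i' j' : pd m (fun y => w a y i' j') x = - pd m (fun y => w a y j' i') x.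
  rewrite -pdN//; apply: near_pd.
  have : nbhs x (cimg a) by apply: open_nbhs_nbhs; split=> //; exact: cimg_open.
  by apply: filterS => y ay; rewrite -!bil_delta skew.
(* By skewness the two gradient terms with factor [1/2] combine into a full derivative, the third
   term of the cyclic sum. *)
rewrite (skew_pd l k i) (skew_pd k i l); lra.
Qed.

Lemma antidiag_block_closed_real : s = 1 ->
  closed_eigenbundle (@transTT R n M A) courant_bracket (antidiag_block p w) 1 ->
  everywhere (fun a x => forall i k l,
    pd i (fun y => w a y k l) x + pd k (fun y => w a y l i) x
    + pd l (fun y => w a y i k) x = 0).
Proof.
move=> s1 cl; apply: closed_of_lower => X Y sX sY a x ax XY0.
pose Z (X : components A 'cV[R]_n) : components A 'cV[R]_(n + n) :=
  fun a y => col_mx (X a y) (F a y *m X a y).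
(* [Z X'] is the image of [X' + 0] under [1 + S], hence smooth; it is fixed by [S] because
   [p F = 1]. *)
have sZ X' : smooth_section (@transT R n M A) X' ->
    smooth_section (@transTT R n M A) (Z X').
  move=> sX'; have sc := smooth_section_col0 sX'.
  have := smooth_sectionD sc (smooth_section_endo sS sc).
  congr smooth_section; apply/funext => b; apply/funext => y.
  by rewrite antidiag_block_col mulmx0 add_col_mx addr0 add0r.
have eZ X' : in_eigenbundle (antidiag_block p w) 1 (Z X').
  move=> b y by_; rewrite antidiag_block_col mulmxA scale1r.
  by have [-> _] := antidiag_block_square SS by_; rewrite s1 mul1mx.
have := cl _ _ (sZ _ sX) (sZ _ sY) (eZ X) (eZ Y) a x ax.
have -> : courant_bracket (Z X a) (Z Y a) x = col_mx 0 (lower a (X a) (Y a) x).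
  by rewrite courant_bracket_col XY0.
by rewrite antidiag_block_col mulmx0 scale1r => /eq_col_mx[].
Qed.

Lemma antidiag_block_closed_complex : s = -1 ->
  closed_complex_eigenbundle (@transTT R n M A) courant_bracket
    (antidiag_block p w) (- 'i%C) ->
  everywhere (fun a x => forall i k l,
    pd i (fun y => w a y k l) x + pd k (fun y => w a y l i) x
    + pd l (fun y => w a y i k) x = 0).
Proof.
move=> s1 cl; apply: closed_of_lower => X Y sX sY a x ax XY0.
pose re (X : components A 'cV[R]_n) : components A 'cV[R]_(n + n) :=
  fun a y => col_mx (X a y) 0.
pose im (X : components A 'cV[R]_n) : components A 'cV[R]_(n + n) :=
  fun a y => col_mx 0 (F a y *m X a y).
pose Z (X : components A 'cV[R]_n) : components A 'cV[R[i]]_(n + n) :=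
  fun a y => cplx_col (re X a y) (im X a y).
have reE X' b : re_field (Z X' b) = re X' b.
  by apply/funext => y; exact: cplx_col_Re.
have imE X' b : im_field (Z X' b) = im X' b.
  by apply/funext => y; exact: cplx_col_Im.
have sZ X' : smooth_section (@transT R n M A) X' ->
    smooth_complex_section (@transTT R n M A) (Z X').
  move=> sX'; have sc := smooth_section_col0 sX'; split.
    by have := sc; congr smooth_section; apply/funext => b; rewrite reE.
  have := smooth_section_endo sS sc; congr smooth_section.
  apply/funext => b; rewrite imE; apply/funext => y.
  by rewrite antidiag_block_col mulmx0.
have eZ X' : in_complex_eigenbundle (antidiag_block p w) (- 'i%C) (Z X').
  move=> b y by_; apply/cplx_col_eigen; rewrite /re /im !antidiag_block_col.
  rewrite !mulmx0; split=> //; rewrite mulmxA.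
  have [-> _] := antidiag_block_square SS by_.
  by rewrite s1 mul_scalar_mx scaleN1r opp_col_mx oppr0.
have := cl _ _ (sZ _ sX) (sZ _ sY) (eZ X) (eZ Y) a x ax.
rewrite /C_bilinear_ext (reE X) (reE Y) (imE X) (imE Y).
(* The real part of the bracket has zero vector part: [[X, Y]] vanishes at [x], and [F X], [F Y] are
   pure covectors. Applying [S] shows that the covector part of the imaginary part, which is
   [lower], is zero. *)
move=> /cplx_col_eigen[+ _]; rewrite /re /im !courant_bracket_col XY0.
have lb00 : lie_bracket (fun=> 0) (fun=> 0) x = 0 :> 'cV[R]_n.
  by rewrite /lie_bracket jac_cst !mul0mx subrr.
have ld00 : lie_deriv (fun=> 0) (fun=> 0) x = 0 :> 'cV[R]_n.
  by rewrite /lie_deriv jac_cst trmx0 !mul0mx addr0.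
rewrite lb00 ld00 opp_col_mx !add_col_mx oppr0 addr0 antidiag_block_col mulmx0.
move=> /eq_col_mx[_ /esym E]; rewrite -[RHS]E /lower.
have dF i' j' : differentiable (fun y => F a y i' j') x.
  rewrite (_ : (fun y => _) = fun y => w a y j' i').
    by apply: smooth_cimg_differentiable => //; have [] := antidiag_block_smooth sS.
  by apply/funext => y; rewrite mxE.
have dX i' : differentiable (fun y => X a y i' 0) x.
  by apply: smooth_cimg_differentiable => //; case: sX.
have dY i' : differentiable (fun y => Y a y i' 0) x.
  by apply: smooth_cimg_differentiable => //; case: sY.
(* The mixed brackets [[X, F Y]] and [[F X, Y]] each contribute one of the two pairings; the
   constant zero pairings that accompany them cancel in the sum. *)
pose f1 y := pairing (F a y *m Y a y) (X a y) - pairing (0 : 'cV[R]_n) 0.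
pose f2 y := pairing (0 : 'cV[R]_n) 0 - pairing (F a y *m X a y) (Y a y).
rewrite -/f1 -/f2.
have -> : (fun y => pairing (F a y *m Y a y) (X a y) - pairing (F a y *m X a y) (Y a y))
    = fun y => f1 y + f2 y.
  by apply/funext => y; rewrite /f1 /f2 subrKA.
rewrite gradD; last 2 first.
- by apply: differentiableB; [exact: differentiable_pairing|exact: differentiable_cst].
- by apply: differentiableB; [exact: differentiable_cst|exact: differentiable_pairing].
move: (lie_deriv _ _ _) (lie_deriv _ _ _) (grad _ _) (grad _ _) => a1 a2 a3 a4.
by apply/matrixP => i' j'; rewrite !mxE; ring.
Qed.

End Closedness.
End AntidiagonalStructures.

(** * Interpolation between the two kinds of structures *)

Section MainTheorem.
Context {R : realType} {n : nat} {M : topologicalType} (A : manifold R n M).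

(** Closedness is asked of the eigenbundle that is a graph over [TM] or its complexification: this
    is the information on [Q] common to both parts of the theorem. *)
Lemma antidiag_block_integrable_0l l (lambda : sign) (j p w : components A 'M[R]_n) :
  skew_split_section lambda (antidiag_block p w) ->
  match lambda with
  | Plus => closed_eigenbundle (@transTT R n M A) courant_bracket (antidiag_block p w) 1
  | Minus => closed_complex_eigenbundle (@transTT R n M A) courant_bracket
               (antidiag_block p w) (- 'i%C)
  end ->
  anticommute (antidiag_block p w) (J_l l j) ->
  integrable_0l_structure l j w.
Proof.
move=> [sS SS _ skS] cl aJ.
have skew := antidiag_block_skew skS.
have s0 : sval_sign R lambda != 0.
  by case: lambda {SS cl} => /=; rewrite ?oppr_eq0 oner_neq0.
split; last first.
  move=> a x ax u v; have := antidiag_block_anticommute aJ ax u v.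
  by case: l {aJ} => /= ->; rewrite ?mul1r ?mulN1r ?opprK.
split=> //.
- exact: antidiag_block_smooth sS.
- exact: antidiag_block_nondegenerate s0 SS.
- case: lambda cl SS {s0} => cl SS.
    exact: (antidiag_block_closed_real sS skew SS erefl cl).
  exact: (antidiag_block_closed_complex sS skew SS erefl cl).
Qed.

End MainTheorem.

Theorem theorem3p4 (R : realType) (n : nat) (M : topologicalType)
    (A : manifold R n M) (j : components A 'M[R]_n)
    (hj : complex_structure j) :
  (forall (lambda l : sign) (r t p omega : components A 'M[R]_n),
     integrable_structure lambda l j (diag_block r t) ->
     integrable_structure lambda l j (antidiag_block p omega) ->
     integrable_l0_structure lambda j r /\ integrable_0l_structure l j omega)
  /\
  (forall (l : sign) (r t p omega : components A 'M[R]_n),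
     plus_integrable_structure l j (diag_block r t) ->
     plus_integrable_structure l j (antidiag_block p omega) ->
     plus_integrable_10_structure j r /\ integrable_0l_structure l j omega).
Proof.
have [_ jj _ _] := hj.
split=> [lambda l r t p w [HR aR] [HQ aQ]|l r t p w [[skR clR] aR] [[skQ clQ] aQ]].
- have aj := diag_block_anticommute aR.
  split.
    split=> //; case: lambda HR {HQ} => -[[sR RR _ _] cl1 cl2].
      have sr := smooth_endo_diag_block sR; have rr := diag_block_square RR.
      split=> //.
      + apply: (closed_eigenbundle_integrable (mulr1 1) sr rr jj aj).
        exact: closed_diag_block cl1.
      + have ee : (-1 : R) * -1 = 1 by rewrite mulrNN mulr1.
        apply: (closed_eigenbundle_integrable ee sr rr jj aj).
        exact: closed_diag_block cl2.
      + move=> a x ax; apply: rank_eigenspaces_anticommute (jj a x ax) _.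
        exact: aj.
    (* [complex_structure] is phrased through closed eigenbundles, so closedness of the blocks is
       already the conclusion. *)
    split.
    + exact: smooth_endo_diag_block sR.
    + move=> a x ax; have := diag_block_square RR ax.
      by rewrite raddfN.
    + exact: closed_complex_diag_block cl1.
    + exact: closed_complex_diag_block cl2.
  case: lambda HR HQ => _ [skQ cl1 cl2].
    exact: (antidiag_block_integrable_0l skQ cl1 aQ).
  exact: (antidiag_block_integrable_0l skQ cl2 aQ).
- have aj := diag_block_anticommute aR; have [sR RR _ _] := skR.
  have sr := smooth_endo_diag_block sR; have rr := diag_block_square RR.
  split; last exact: (antidiag_block_integrable_0l skQ clQ aQ).
  split=> //; apply: (closed_eigenbundle_integrable (mulr1 1) sr rr jj aj).
  exact: closed_diag_block clR.
Qed.
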